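(* Let $P=(X,\prec)$ be a finite poset of width two with $n=|X|$ elements, with a fixed partition $X=\mathcal{C}_1\sqcup\mathcal{C}_2$ into chains $\mathcal{C}_1=\{\alpha_1\prec\cdots\prec\alpha_{a}\}$, $\mathcal{C}_2=\{\beta_1\prec\cdots\prec\beta_{b}\}$. Let $x,y\in X$ be distinct with either $x,y\in\mathcal{C}_1$ or $x,y\in\mathcal{C}_2$. For integers $j$ let $F(j)$ be the number of linear extensions $L$ of $P$ with $L(y)-L(x)=j$, and $F_q(j):=\sum_{L\in\mathcal{E}(P):L(y)-L(x)=j}q^{\mathrm{wgt}(L)}$. Suppose $k\in\{2,\dots,n-2\}$ and $F(k)>0$. Then the following are equivalent: (a) $F(k)^2=F(k-1)\,F(k+1)$; (b) $F(k)=F(k+1)=F(k-1)$; (c) $F_q(k)^2=F_q(k-1)\,F_q(k+1)$; (d) $F_q(k)=q^{\varepsilon}F_q(k-1)=q^{-\varepsilon}F_q(k+1)$ for some $\varepsilon\in\{1,-1\}$; (e) there is an element $z\in\{x,y\}$ such that for every linear extension $L$ with $L(y)-L(x)=k$ there are elements $u,v\in X$ with $u\,\|\,z$, $v\,\|\,z$, and $L(u)+1=L(z)=L(v)-1$.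
   Context: A linear extension of $P$ is a bijection $L:X\to\{1,\dots,n\}$ with $L(u)<L(v)$ whenever $u\prec v$; $\mathcal{E}(P)$ is the set of linear extensions, and $\mathrm{wgt}(L):=\sum_{i=1}^{a}L(\alpha_i)$. $u\,\|\,v$ means $u$ and $v$ are incomparable. *)

(* Defs.v *)
From HB Require Import structures.
From mathcomp Require Import all_boot all_order all_algebra.

Set Implicit Arguments.
Unset Strict Implicit.
Unset Printing Implicit Defensive.

Import Order.TTheory GRing.Theory Num.Theory.
Local Open Scope ring_scope.

Definition antichain (d : Order.disp_t) (X : finPOrderType d) (A : {set X}) : bool :=
  [forall u in A, forall v in A, (u != v) ==> (u >< v)%O].

Definition width (d : Order.disp_t) (X : finPOrderType d) : nat :=
  (\max_(A : {set X} | antichain A) #|A|)%N.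

(* alpha i and beta i are the elements written alpha_(i+1) and beta_(i+1) in
   1-based notation. *)
Definition chain_partition (d : Order.disp_t) (X : finPOrderType d) (a b : nat)
    (alpha : 'I_a -> X) (beta : 'I_b -> X) : Prop :=
  [/\ forall i j : 'I_a, (i < j)%N -> (alpha i < alpha j)%O,
      forall i j : 'I_b, (i < j)%N -> (beta i < beta j)%O,
      forall u : X, u \in codom alpha \/ u \in codom beta
    & forall u : X, ~ (u \in codom alpha /\ u \in codom beta)].

(* A labelling takes values in {0, ..., n-1}; [label] shifts it to the
   1-based value L(u) in {1, ..., n}. *)
Definition label (d : Order.disp_t) (X : finPOrderType d)
    (L : {ffun X -> 'I_#|X|}) (u : X) : nat := (L u).+1.

Definition is_linext (d : Order.disp_t) (X : finPOrderType d)
    (L : {ffun X -> 'I_#|X|}) : bool :=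
  [&& injectiveb L, [forall i, i \in codom L]
    & [forall u, forall v, (u < v)%O ==> (label L u < label L v)%N]].

Lemma is_linextP (d : Order.disp_t) (X : finPOrderType d)
    (L : {ffun X -> 'I_#|X|}) :
  reflect (bijective L /\ forall u v : X, (u < v)%O -> (label L u < label L v)%N)
          (is_linext L).
Proof.
apply: (iffP and3P) => [[/injectiveP injL _ /forallP homL]|[bijL homL]].
  split; first by apply: inj_card_bij => //; rewrite card_ord.
  by move=> u v uv; move/forallP: (homL u) => /(_ v); rewrite uv.
split; first by apply/injectiveP; exact: bij_inj.
  by apply/forallP => i; case: bijL => g _ gK; rewrite -(gK i) codom_f.
by apply/forallP => u; apply/forallP => v; apply/implyP; exact: homL.
Qed.

Definition linexts_gap (d : Order.disp_t) (X : finPOrderType d) (x y : X)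
    (j : int) : {set {ffun X -> 'I_#|X|}} :=
  [set L | is_linext L & (label L y)%:Z - (label L x)%:Z == j].

Definition wgt (d : Order.disp_t) (X : finPOrderType d) (a : nat)
    (alpha : 'I_a -> X) (L : {ffun X -> 'I_#|X|}) : nat :=
  (\sum_(i < a) label L (alpha i))%N.

Definition F (d : Order.disp_t) (X : finPOrderType d) (x y : X) (j : int) : nat :=
  #|linexts_gap x y j|.

Definition Fq (d : Order.disp_t) (X : finPOrderType d) (a : nat)
    (alpha : 'I_a -> X) (x y : X) (j : int) : {poly int} :=
  \sum_(L in linexts_gap x y j) 'X^(wgt alpha L).

(* The identities involving q^-1 are stated in Frac(Z[q]), which contains
   Z[q, q^-1]. *)
Definition to_fracq (p : {poly int}) : {fraction {poly int}} := FracField.tofrac p.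

(* Main.v *)
(* Let x = alpha_r and y = alpha_s.  A linear extension is the same as a lattice
   path, given by the numbers h_i of elements of the second chain that precede
   alpha_i.  If G(p, g) is the number of paths with h_r = p and h_s = g, then
   F(k) is the sum of G(p, p + m) over p, with m = k - (s - r).  Cutting and
   exchanging two paths at a crossing, after a vertical shift of one of them,
   gives for x <= y, with
     S(x, y) = G(x + 1, x + m) G(y, y + m + 1),
     T(x, y) = G(x + 1, x + m + 1) G(y, y + m),
   the inequalities S(x, y) <= T(x, y), S(y, x) <= T(x, y) and
   S(x, y) S(y, x) <= T(x, y) T(y, x), hence
   S(x, y) + S(y, x) <= T(x, y) + T(y, x).  Summing over all x and y yields
   F(k - 1) F(k + 1) <= F(k)^2.  In the case of equality, the terms for the two
   ends of the support of p |-> G(p, p + m) give G(p, g)^2 = G(p, g - 1) G(p, g + 1)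
   for all p, or the same in the first variable; and log-concavity of a cumulative
   sum is strict unless the summand vanishes, so that h_(z-1) < h_z < h_(z+1) and
   h_z can be moved both ways, which is (e).  Conversely, under (e) exchanging z
   with its two neighbours injects the linear extensions with gap k into those
   with gap k - 1 and k + 1, shifting the weight by a constant; by log-concavity
   these injections are bijections. *)
Require Import Defs.
From mathcomp Require Import all_boot all_order all_algebra.
From mathcomp Require Import perm zify.

Set Implicit Arguments.
Unset Strict Implicit.
Unset Printing Implicit Defensive.

Import Order.TTheory GRing.Theory Num.Theory.

(** * Exchange inequalities *)

(* If [f] and [f'] count the paths from the heights [c] and [c'], then the
   condition says that the first path, shifted up by [d], starts weakly above
   the second one; it ends weakly below it, so the two meet. *)
Definition exch (c c' : nat) (f f' : nat -> nat) : Prop :=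
  forall x e d, c' <= c + d -> f x * f' (x + e + d) <= f (x + e) * f' (x + d).

(** If neither factor on the left vanishes, then [c' = c + e + d], and the side condition forces
    [e = 0]. *)
Lemma exch_delta (c c' : nat) :
  exch c c' (fun x => (x == c : nat)) (fun x => (x == c' : nat)).
Proof.
move=> x e d cd; case: (x =P c) => [xc|_]; last by rewrite mul0n.
case: (_ =P c') => [xc'|_]; last by rewrite muln0.
by rewrite (_ : e = 0) ?addn0 -?xc -?xc' ?eqxx //; lia.
Qed.

(** The points [x + e] and [x + d] lie between [x] and [x + e + d], so convexity of [p] keeps the
    right side whenever the left side survives. *)
Lemma exch_trunc (p : pred nat) (c c' : nat) (f f' : nat -> nat) :
  (forall x y z, x <= y <= z -> p x -> p z -> p y) ->
  exch c c' f f' -> exch c c' (fun x => p x * f x) (fun x => p x * f' x).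
Proof.
move=> convp ff' x e d cd; have := ff' x e d cd.
case px: (p x); last by rewrite !mul0n.
case pz: (p (x + e + d)); last by rewrite !mul0n muln0.
by rewrite (convp x (x + e) (x + e + d)) ?(convp x (x + d) (x + e + d)) ?mul1n //; lia.
Qed.

(** Once the common part of the two products is cancelled, pairs [v <= x < j] are compared term by
    term: [f v * f' (j + d) <= f j * f' (v + d)]. The values of [f'] below [d] are left over on the
    right. *)
Lemma exch_sum_le (c c' : nat) (f f' : nat -> nat) :
  exch c c' f f' ->
  exch c c' (fun x => \sum_(0 <= v < x.+1) f v) (fun x => \sum_(0 <= v < x.+1) f' v).
Proof.
move=> ff' x e d cd.
rewrite (@big_cat_nat _ _ _ (x + d).+1 0 (x + e + d).+1) //=; last by lia.
rewrite (@big_cat_nat _ _ _ x.+1 0 (x + e).+1) //=; last by lia.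
rewrite mulnDr mulnDl leq_add2l big_distrlr /= exchange_big /=.
have -> : (x + d).+1 = d + x.+1 by lia.
have -> : (x + e + d).+1 = d + (x + e).+1 by lia.
rewrite [X in _ <= X]big_distrlr /=.
rewrite [X in X <= _](_ : _ = \sum_(x.+1 <= j < (x + e).+1)
    \sum_(0 <= i < x.+1) f i * f' (d + j)); last first.
  rewrite -{1}[d + x.+1]addnC big_addn; apply: congr_big_nat => //; first by lia.
  by move=> j _; apply: eq_bigr => i _; rewrite addnC.
rewrite big_nat_cond [X in _ <= X]big_nat_cond; apply: leq_sum => j /andP[/andP[xj jx] _].
rewrite [X in _ <= X](@big_cat_nat _ _ _ d) ?leq_addr //=.
apply: leq_trans (leq_addl _ _).
rewrite [X in _ <= X](_ : _ = \sum_(0 <= v < x.+1) f j * f' (v + d)); last first.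
  by rewrite -{1}[d]add0n big_addn addKn.
rewrite big_nat_cond [X in _ <= X]big_nat_cond; apply: leq_sum => v /andP[/andP[_ vx] _].
have := ff' v (j - v) d cd.
by rewrite (_ : v + (j - v) = j) 1?[j + d]addnC //; lia.
Qed.

(** Mirror image of [exch_sum_le], with pairs [j < x + e <= v]. The shifted sum of [f'] stops at
    [W - d]; the values of [f] from there on are left over on the right. *)
Lemma exch_sum_ge (W c c' : nat) (f f' : nat -> nat) :
  exch c c' f f' ->
  exch c c' (fun x => \sum_(x <= v < W) f v) (fun x => \sum_(x <= v < W) f' v).
Proof.
move=> ff' x e d cd; have [Wx|xW] := leqP W (x + e + d).
  by rewrite [X in _ * X]big_geq ?muln0.
rewrite (@big_cat_nat _ _ _ (x + e) x W) /=; try by lia.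
rewrite (@big_cat_nat _ _ _ (x + e + d) (x + d) W) /=; try by lia.
rewrite mulnDl mulnDr leq_add2r.
have -> : x + e + d = d + (x + e) by lia.
rewrite (addnC x d).
rewrite big_distrlr /= big_distrlr /= [X in _ <= X]exchange_big /=.
rewrite [X in _ <= X](_ : _ = \sum_(x <= j < x + e)
    \sum_(x + e <= v < W) f v * f' (d + j)); last first.
  rewrite -{1}[d + x]addnC big_addn; apply: congr_big_nat => //; first by lia.
  by move=> j _; apply: eq_bigr => i _; rewrite addnC.
rewrite big_nat_cond [X in _ <= X]big_nat_cond; apply: leq_sum => j /andP[/andP[xj jx] _].
rewrite (_ : d + (x + e) = (x + e) + d) ?[d + _]addnC // big_addn.
rewrite [X in _ <= X](@big_cat_nat _ _ _ (W - d)) /=; try by lia.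
apply: leq_trans (leq_addr _ _).
rewrite big_nat_cond [X in _ <= X]big_nat_cond; apply: leq_sum => v /andP[/andP[xv vW] _].
have := ff' j (v - j) d cd.
by rewrite (_ : j + (v - j) = v) 1?[d + j]addnC //; lia.
Qed.

(** With equal starts the side condition of [exch] is vacuous. Allowing all [e] and [d], and not
    just [1], also rules out gaps in the support. *)
Definition logconcave (f : nat -> nat) : Prop := exch 0 0 f f.

Lemma exch_refl (c : nat) (f : nat -> nat) : exch c c f f <-> logconcave f.
Proof. by split=> ff x e d _; apply: ff; rewrite leq_addr. Qed.

(** With [S] the sum up to [g.+1] and [C] the sum up to [g], the hypothesis reads
    [S * f g.+1 <= C * f g.+2]. Log-concavity gives [f v * f g.+2 <= f v.+1 * f g.+1]; the shift of
    index leaves over the first support point [j], so [C * f g.+2 + f j * f g.+1 <= S * f g.+1]. *)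
Lemma logconcave_sum_le_strict (f : nat -> nat) (g : nat) :
  logconcave f ->
  (\sum_(0 <= v < g.+2) f v) ^ 2 <=
    (\sum_(0 <= v < g.+1) f v) * (\sum_(0 <= v < g.+3) f v) ->
  f g.+1 = 0.
Proof.
move=> lf; rewrite (big_nat_recr g.+2) //= (big_nat_recr g.+1) //=.
set C := \sum_(0 <= v < g.+1) f v => H.
have [//|fg0] := posnP (f g.+1).
have ex0 : exists j, 0 < f j by exists g.+1.
case: (ex_minnP ex0) => j fj jmin; have jg := jmin _ fg0.
have : C * f g.+2 + f j * f g.+1 <= (\sum_(0 <= v < g.+2) f v) * f g.+1.
  have zero n : n <= j -> \sum_(0 <= v < n) f v = 0.
    move=> nj; rewrite big_nat_cond big1 // => v /andP[/andP[_ vn] _].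
    by apply/eqP; rewrite -leqn0 leqNgt; apply/negP => /jmin; lia.
  have jg2 : j <= g.+2 by exact: leqW.
  have [jg1|jg1] := leqP j g; last first.
    rewrite /C zero // mul0n add0n (_ : j = g.+1); last by lia.
    by rewrite big_nat_recr //= mulnDl leq_addl.
  rewrite /C (@big_cat_nat _ _ _ j 0 g.+1) //= (zero j) ?add0n; try by lia.
  rewrite (@big_cat_nat _ _ _ j 0 g.+2) //= (zero j) ?add0n; try by lia.
  rewrite [X in _ <= X * _]big_ltn; last by lia.
  rewrite mulnDl addnC leq_add2l big_add1 /= !big_distrl /=.
  rewrite big_nat_cond [X in _ <= X]big_nat_cond; apply: leq_sum => v /andP[/andP[jv vg] _].
  have := lf v 1 (g - v).+1 isT.
  have -> : v + 1 + (g - v).+1 = g.+2 by lia.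
  have -> : v + (g - v).+1 = g.+1 by lia.
  by rewrite addn1.
rewrite big_nat_recr //= -/C; nia.
Qed.

(** Mirror image, where the shift of index leaves over the last support point below [W]. *)
Lemma logconcave_sum_ge_strict (W : nat) (f : nat -> nat) (g : nat) :
  logconcave f ->
  (\sum_(g.+1 <= v < W) f v) ^ 2 <=
    (\sum_(g <= v < W) f v) * (\sum_(g.+2 <= v < W) f v) ->
  f g.+1 = 0 \/ W <= g.+1.
Proof.
move=> lf; have [|gW] := leqP W g.+1; first by right.
rewrite (big_ltn (ltnW gW)) (big_ltn gW).
set C := \sum_(g.+2 <= v < W) f v => H; left.
have [//|fg0] := posnP (f g.+1).
have bnd j : (0 < f j) && (j < W) -> j <= W by lia.
have ex0 : exists j, (0 < f j) && (j < W) by exists g.+1; rewrite fg0.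
case: (ex_maxnP ex0 bnd) => j /andP[fj jW] jmax.
have jg : g.+1 <= j by apply: jmax; rewrite fg0.
have : C * f g + f j * f g.+1 <= (\sum_(g.+1 <= v < W) f v) * f g.+1.
  have zero n : j < n -> \sum_(n <= v < W) f v = 0.
    move=> nj; rewrite big_nat_cond big1 // => v /andP[/andP[vn vW] _].
    have [//|fv0] := posnP (f v).
    by have := jmax v; rewrite fv0 vW; lia.
  have jg2 : g.+2 <= j.+1 by [].
  have jg3 : g.+1 <= j.+1 by exact: leqW.
  rewrite /C (@big_cat_nat _ _ _ j.+1 g.+2) //= (zero j.+1) ?addn0; try by lia.
  rewrite (@big_cat_nat _ _ _ j.+1 g.+1) //= (zero j.+1) ?addn0; try by lia.
  rewrite [X in _ <= X * _]big_nat_recr //= mulnDl leq_add2r big_add1 /= !big_distrl /=.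
  rewrite big_nat_cond [X in _ <= X]big_nat_cond; apply: leq_sum => v /andP[/andP[jv vg] _].
  have := lf g 1 (v - g) isT.
  have -> : g + 1 + (v - g) = v.+1 by lia.
  have -> : g + (v - g) = v by lia.
  by rewrite addn1 mulnC [X in _ <= X]mulnC.
rewrite big_ltn // -/C; nia.
Qed.

Lemma eq_exch (c c' : nat) (f f' g g' : nat -> nat) :
  f =1 g -> f' =1 g' -> exch c c' f f' -> exch c c' g g'.
Proof. by move=> fg fg' ff' x e d cd; rewrite -!fg -!fg'; exact: ff'. Qed.

Lemma exch_mul (c c' : nat) (f f' g g' : nat -> nat) :
  exch c c' f f' -> exch c c' g g' ->
  exch c c' (fun x => f x * g x) (fun x => f' x * g' x).
Proof.
by move=> ff' gg' x e d cd; rewrite mulnACA [leqRHS]mulnACA leq_mul ?ff' ?gg'.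
Qed.

Lemma exch_const (c c' k k' : nat) : exch c c' (fun=> k) (fun=> k').
Proof. by []. Qed.

(* From (t - p) * (t - q) >= 0. *)
Lemma leq_add_of_mul (p q t t' : nat) :
  p <= t -> q <= t -> p * q <= t * t' -> p + q <= t + t'.
Proof.
move=> pt qt pq; have [t0|t0] := posnP t; first by lia.
by rewrite -(leq_pmul2l t0); nia.
Qed.

(** If [p] and [q] were both less than [t], then [t * (t + t' - p - q) >= (t - p) * (t - q) > 0]. *)
Lemma eq_add_of_mul (p q t t' : nat) :
  p <= t -> q <= t -> p * q <= t * t' -> p + q = t + t' -> p = t \/ q = t.
Proof.
move=> pt qt pq; have [->|pNt] := eqVneq p t; first by left.
have [->|qNt] := eqVneq q t; first by right.
by move=> e; exfalso; have : (t - p) * (t - q) > 0; nia.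
Qed.

(** * Sums along the diagonals of an array with exchange inequalities *)

Section GapSums.
Variables (G : nat -> nat -> nat) (m W : nat).
Hypothesis G_end : forall p p', exch p p' (G p) (G p').
Hypothesis G_start : forall g g', exch g g' (fun p => G p g) (fun p => G p g').
Hypothesis G0 : forall g, G 0 g = 0.
Hypothesis GW : forall p g, W <= p -> G p g = 0.

Let s x y := G x.+1 (x + m) * G y (y + m).+1.
Let t x y := G x.+1 (x + m).+1 * G y (y + m).

(** Exchange of the second arguments, with shift [d = y - x]: the side condition is
    [y <= x.+1 + d]. *)
Lemma gap_exch_end x y : x <= y -> s x y <= t x y.
Proof.
move=> xy; have := @G_end x.+1 y (x + m) 1 (y - x).
have -> : x + m + 1 + (y - x) = (y + m).+1 by lia.
have -> : x + m + (y - x) = y + m by lia.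
by rewrite addn1; apply; lia.
Qed.

Lemma gap_exch_start x y : x <= y -> s y x <= t x y.
Proof.
move=> xy; have := @G_start (x + m).+1 (y + m) x 1 (y - x).
have -> : x + 1 + (y - x) = y.+1 by lia.
have -> : x + (y - x) = y by lia.
by rewrite addn1 /s mulnC; apply; lia.
Qed.

(** Regrouped by [x] and by [y], the claim is a product of two unshifted exchanges. *)
Lemma gap_exch_mul x y : s x y * s y x <= t x y * t y x.
Proof.
have sub z : G z.+1 (z + m) * G z (z + m).+1 <= G z.+1 (z + m).+1 * G z (z + m).
  by have := @G_end z.+1 z (z + m) 1 0; rewrite !addn0 !addn1; apply.
rewrite /s /t [leqLHS](_ : _ = G x.+1 (x + m) * G x (x + m).+1 *
  (G y.+1 (y + m) * G y (y + m).+1)); last by lia.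
rewrite [leqRHS](_ : _ = G x.+1 (x + m).+1 * G x (x + m) *
  (G y.+1 (y + m).+1 * G y (y + m))); last by lia.
by rewrite leq_mul.
Qed.

Lemma gap_sym_le x y : s x y + s y x <= t x y + t y x.
Proof.
wlog xy : x y / x <= y.
  by move=> H; case: (leqP x y) => [/H//|/ltnW/H]; rewrite addnC [leqRHS]addnC.
by apply: leq_add_of_mul; rewrite ?gap_exch_end ?gap_exch_start ?gap_exch_mul.
Qed.

Definition gap_sum0 := \sum_(x < W) G x.+1 (x + m).+1.
Definition gap_sum_pred := \sum_(x < W) G x.+1 (x + m).
Definition gap_sum_succ := \sum_(x < W) G x (x + m).+1.

(** Both indexings of the diagonal occur, since [t x y] pairs a first height [x.+1] with a first
    height [y]; they differ by terms at [0] and [W], which vanish. *)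
Lemma gap_sum0_shift : gap_sum0 = \sum_(x < W) G x (x + m).
Proof.
have := erefl (\sum_(i < W.+1) G i (i + m)).
rewrite {1}big_ord_recl big_ord_recr /= G0 GW // addn0 add0n => <-.
by apply: eq_bigr => i _; rewrite /bump add1n.
Qed.

(** Only the symmetrized terms can be compared, hence the doubling. *)
Lemma gap_double_sums :
  (gap_sum_pred * gap_sum_succ).*2 = \sum_(x < W) \sum_(y < W) (s x y + s y x) /\
  (gap_sum0 ^ 2).*2 = \sum_(x < W) \sum_(y < W) (t x y + t y x).
Proof.
have dbl (f : nat -> nat -> nat) : (\sum_(x < W) \sum_(y < W) f x y).*2 =
    \sum_(x < W) \sum_(y < W) (f x y + f y x).
  rewrite -addnn {2}exchange_big -big_split; apply: eq_bigr => x _ /=.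
  by rewrite -big_split.
by rewrite -!dbl -mulnn {2}gap_sum0_shift !big_distrlr.
Qed.

Theorem gap_sum_logconcave : gap_sum_pred * gap_sum_succ <= gap_sum0 ^ 2.
Proof.
case: gap_double_sums => e1 e2; rewrite -leq_double e1 e2.
by apply: leq_sum => x _; apply: leq_sum => y _; exact: gap_sym_le.
Qed.

Lemma gap_sum_eq x y : gap_sum_pred * gap_sum_succ = gap_sum0 ^ 2 ->
  x < W -> y < W -> s x y + s y x = t x y + t y x.
Proof.
case: gap_double_sums => e1 e2 e xW yW.
have leS (u : 'I_W) : true -> \sum_(v < W) (s u v + s v u) <= \sum_(v < W) (t u v + t v u)
    ?= iff (\sum_(v < W) (s u v + s v u) == \sum_(v < W) (t u v + t v u)).
  by move=> _; split=> //; apply: leq_sum => v _; exact: gap_sym_le.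
have := leqif_sum leS; rewrite -e1 -e2 e => -[_]; rewrite eqxx.
move=> /esym/forallP/(_ (Ordinal xW))/=.
have leT (v : 'I_W) : true -> s x v + s v x <= t x v + t v x
    ?= iff (s x v + s v x == t x v + t v x).
  by move=> _; split=> //; exact: gap_sym_le.
have := leqif_sum leT => -[_ ->] /forallP/(_ (Ordinal yW)).
by move=> /eqP.
Qed.

(* The first and last points of the support of [fun p => G p (p + m)] force
   the same alternative at all points between them, since both ratios of
   consecutive values are monotone along the diagonal. *)
Theorem gap_sum_eq_cases : gap_sum_pred * gap_sum_succ = gap_sum0 ^ 2 ->
  (forall x, 0 < G x.+1 (x + m).+1 ->
     G x.+1 (x + m).+1 ^ 2 <= G x.+1 (x + m) * G x.+1 (x + m).+2) \/
  (forall x, 0 < G x.+1 (x + m).+1 ->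
     G x.+1 (x + m).+1 ^ 2 <= G x (x + m).+1 * G x.+2 (x + m).+1).
Proof.
move=> e; pose P x := 0 < G x.+1 (x + m).+1.
have Pbound x : P x -> x <= W.
  by rewrite /P; case: (leqP x W) => // Wx; rewrite GW // ltnW // ltnW.
have PW x : P x -> x.+1 < W.
  by rewrite /P ltnNge; case: leqP => // Wx; rewrite GW.
have [x0 Px0|noP] := pickP (fun x : 'I_W.+1 => P x); last first.
  left=> x Px; have xW := Pbound x Px.
  by have := noP (Ordinal (xW : x < W.+1)); rewrite /= (Px : P x).
have exP : exists x, P x by exists x0.
case: (ex_minnP exP) => a Pa amin; case: (ex_maxnP exP Pbound) => b Pb bmax.
have ab : a <= b.+1 by apply/leqW/amin.
(* [t a b.+1] is the product of the values at the two ends of the support. *)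
have tpos : 0 < t a b.+1 by rewrite /t muln_gt0; apply/andP.
have := eq_add_of_mul (gap_exch_end ab) (gap_exch_start ab) (gap_exch_mul a b.+1)
  (gap_sum_eq e (ltnW (PW _ Pa)) (PW _ Pb)).
case=> E; [left|right] => x Px; have ax := amin x Px; have xb := bmax x Px.
(* [h1] compares [a] with [x], and [h2] compares [x] with [b]. In their product the outer factors
   are [s a b.+1] on the left and [t a b.+1] on the right, equal by [E], and they cancel. *)
- have h1 := @G_end a.+1 x.+1 (a + m) 1 (x - a).
  have h2 := @G_end x.+1 b.+1 (x.+1 + m) 1 (b - x).
  move: h1 h2.
  have -> : a + m + 1 + (x - a) = (x + m).+1 by lia.
  have -> : a + m + (x - a) = x + m by lia.
  have -> : x.+1 + m + 1 + (b - x) = (b + m).+2 by lia.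
  have -> : x.+1 + m + (b - x) = (b + m).+1 by lia.
  rewrite !addn1 !addSn => /(_ ltac:(lia)) h1 /(_ ltac:(lia)) h2.
  move: E tpos; rewrite /s /t !addSn => E tpos.
  rewrite -(leq_pmul2l tpos) -{1}E.
  have := leq_mul h1 h2; lia.
- have h1 := @G_start (a + m).+1 (x + m).+1 a 1 (x - a).
  have h2 := @G_start (x + m).+1 (b + m).+1 x.+1 1 (b - x).
  move: h1 h2.
  have -> : a + 1 + (x - a) = x.+1 by lia.
  have -> : a + (x - a) = x by lia.
  have -> : x.+1 + 1 + (b - x) = b.+2 by lia.
  have -> : x.+1 + (b - x) = b.+1 by lia.
  rewrite !addn1 => /(_ ltac:(lia)) h1 /(_ ltac:(lia)) h2.
  move: E tpos; rewrite /s /t !addSn => E tpos.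
  rewrite -(leq_pmul2l tpos) -{1}E.
  have := leq_mul h1 h2; lia.
Qed.

End GapSums.

(** * Counting lattice paths *)

Lemma logconcave_sq (f : nat -> nat) x : logconcave f -> f x * f x.+2 <= f x.+1 ^ 2.
Proof. by move=> /(_ x 1 1 isT); rewrite !addn1 mulnn. Qed.

Lemma logconcave_delta (c : nat) : logconcave (fun x => (x == c : nat)).
Proof. by apply/(exch_refl c); exact: exch_delta. Qed.

Lemma leq_of_mul (x x' y y' : nat) : 0 < y -> y' <= y -> x * y <= x' * y' -> x <= x'.
Proof.
move=> y0 y'y xy; rewrite -(leq_pmul2r y0); apply: leq_trans xy _.
by rewrite leq_mul2l y'y orbT.
Qed.

Section Walks.
Variables (ok : nat -> pred nat) (W : nat).
Hypothesis okW : forall i v, ok i v -> v < W.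
Hypothesis ok_pos : forall i v, ok i v -> 0 < v.
Hypothesis ok_conv : forall i x y z, x <= y <= z -> ok i x -> ok i z -> ok i y.

(* The sum of [phi (v_(i + l - 1))] over all sequences
   [u <= v_i <= ... <= v_(i + l - 1)] with [ok j v_j] for all [j]. *)
Fixpoint wsum i l (phi : nat -> nat) u : nat :=
  if l is l'.+1 then \sum_(u <= v < W) ok i v * wsum i.+1 l' phi v else phi u.

(** The number of these sequences that end at [g]; for [l = 0] the start [u] counts as the end. *)
Definition wnum i l u g := wsum i l (fun v => v == g : nat) u.

(** Each step backwards is a truncation to an interval followed by an upper sum, and both preserve
    [exch]. *)
Lemma wsum_exch i l c c' phi phi' :
  exch c c' phi phi' -> exch c c' (wsum i l phi) (wsum i l phi').
Proof.
move=> H; elim: l i => //= l IHl i.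
by apply: exch_sum_ge; apply: exch_trunc; [exact: ok_conv | exact: IHl].
Qed.

Lemma wnum_exch_start i l g g' :
  exch g g' (fun u => wnum i l u g) (fun u => wnum i l u g').
Proof. exact/wsum_exch/exch_delta. Qed.

(** [wsum] peels off the first step; peeling off the last one instead exhibits the dependence on [g]
    as a truncated lower sum. *)
Lemma wnum_recr i l u g :
  wnum i l.+1 u g = ok (i + l) g * \sum_(0 <= v < g.+1) wnum i l u v.
Proof.
rewrite /wnum; elim: l i u => [|l IHl] i u.
  rewrite /= addn0; have [okg|nokg] := boolP (ok i g); last first.
    rewrite mul0n big1 // => v _; case: eqP => [->|]; last by rewrite muln0.
    by rewrite (negbTE nokg).
  have gW := okW okg; rewrite mul1n.
  have delta a b c : \sum_(a <= v < b) (v == c : nat) = (a <= c < b).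
    rewrite -big_mkcond /= sum1_count -(mem_index_iota a b c).
    by rewrite (@count_uniq_mem _ _ c) // iota_uniq.
  rewrite (eq_bigr (fun v => (v == g : nat))); last first.
    by move=> v _; case: eqP => [->|]; rewrite ?okg ?muln0.
  rewrite delta gW andbT (eq_bigr (fun v => (v == u : nat))); last first.
    by move=> v _; rewrite eq_sym.
  by rewrite delta ltnS.
rewrite [LHS]/=.
under eq_bigr => v _ do rewrite [X in _ * X]IHl mulnCA.
rewrite -big_distrr /= addSnnS; congr (_ * _).
under eq_bigr => v _ do rewrite big_distrr /=.
by rewrite exchange_big.
Qed.

Lemma wnum_exch_end i l u u' : exch u u' (wnum i l u) (wnum i l u').
Proof.
elim: l => [|l IHl].
  apply: (eq_exch _ _ (@exch_delta u u')) => x; by rewrite /wnum /= eq_sym.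
apply: (eq_exch (fun x => esym (wnum_recr i l u x)) (fun x => esym (wnum_recr i l u' x))).
by apply: exch_trunc; [exact: ok_conv | exact: exch_sum_le].
Qed.

(** If [g] or [g.+2] were not allowed, the right side would vanish. Otherwise the lower sums of
    [wnum_recr] meet [logconcave_sum_le_strict]: no sequence has its last step flat at [g.+1]. *)
Lemma wnum_end_strict i l u g : 0 < wnum i l.+1 u g.+1 ->
  wnum i l.+1 u g.+1 ^ 2 <= wnum i l.+1 u g * wnum i l.+1 u g.+2 ->
  [/\ wnum i l u g.+1 = 0, ok (i + l) g & ok (i + l) g.+2].
Proof.
rewrite !wnum_recr; case: (ok _ g.+1) => //; rewrite mul1n => S0.
have S20 : 0 < (\sum_(0 <= v < g.+2) wnum i l u v) ^ 2 by rewrite expn_gt0 S0.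
case: (ok _ g); last by rewrite !mul0n leqNgt S20.
case: (ok _ g.+2); last by rewrite mul0n muln0 leqNgt S20.
rewrite !mul1n => H; split=> //; apply: logconcave_sum_le_strict H.
by apply/(exch_refl u); exact: wnum_exch_end.
Qed.

(** The counterpart for upper sums: no weight comes from a flat first step at [p.+1]. *)
Lemma wsum_start_strict i l phi p : logconcave phi ->
  wsum i l.+1 phi p.+1 ^ 2 <= wsum i l.+1 phi p * wsum i l.+1 phi p.+2 ->
  ok i p.+1 * wsum i.+1 l phi p.+1 = 0.
Proof.
move=> lphi /= H.
have := @logconcave_sum_ge_strict W (fun v => ok i v * wsum i.+1 l phi v) p.
case=> //; first by apply: exch_trunc; [exact: ok_conv | exact: wsum_exch].
move=> Wp; case: (boolP (ok i p.+1)) => [/okW|]; last by rewrite mul0n.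
by rewrite ltnNge Wp.
Qed.

Lemma wsum_gt0 (w : nat -> nat) i l phi :
  (forall j, i <= j < i + l -> w j <= w j.+1 /\ ok j (w j.+1)) ->
  0 < phi (w (i + l)) -> 0 < wsum i l phi (w i).
Proof.
elim: l i => [|l IHl] i; first by rewrite addn0.
move=> H phi0; have [wi oki] : w i <= w i.+1 /\ ok i (w i.+1) by apply: H; lia.
have pos : 0 < wsum i.+1 l phi (w i.+1).
  by apply: IHl; rewrite 1?addSnnS // => j ij; apply: H; lia.
have wW := okW oki.
rewrite /= (big_cat_nat wi (ltnW wW)) /=.
by rewrite [X in _ + X]big_ltn // oki mul1n addnCA ltn_addr.
Qed.

Fixpoint walks i u l : seq (seq nat) :=
  if l is l'.+1
  then [seq v :: w | v <- [seq v <- index_iota u W | ok i v], w <- walks i.+1 v l']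
  else [:: [::]].

Lemma walksP i u l w : reflect
  [/\ size w = l, path leq u w & forall j, j < l -> ok (i + j) (nth 0 w j)]
  (w \in walks i u l).
Proof.
elim: l i u w => [|l IHl] i u w /=.
  rewrite inE; apply: (iffP eqP) => [->//|[]].
  by move=> /eqP; rewrite size_eq0 => /eqP.
apply: (iffP allpairsPdep) => [[v [w' [vin /IHl[sw pw okw] ->]]]|].
  move: vin; rewrite mem_filter mem_index_iota => /andP[okv /andP[uv _]].
  split=> /=; rewrite ?sw ?uv //.
  by case=> [|j] jl /=; rewrite ?addn0 // -addSnnS; exact: okw.
case: w => [[]//|v w [/= [sw] /andP[uv pw] okw]].
exists v, w; split=> //.
  have okv := okw 0 isT; rewrite addn0 /= in okv.
  by rewrite mem_filter mem_index_iota okv uv (okW okv).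
by apply/IHl; split=> // j jl; rewrite addSnnS; exact: (okw j.+1).
Qed.

Lemma walks_uniq i u l : uniq (walks i u l).
Proof.
elim: l i u => //= l IHl i u; apply: allpairs_uniq_dep => //.
  by rewrite filter_uniq ?iota_uniq.
by move=> [v w] [v' w'] _ _ /= [-> ->].
Qed.

Lemma sum_walks_recl i u l (phi : seq nat -> nat) :
  \sum_(w <- walks i u l.+1) phi w =
  \sum_(u <= v < W) ok i v * \sum_(w <- walks i.+1 v l) phi (v :: w).
Proof.
rewrite /= big_allpairs_dep big_filter big_mkcond /=.
by apply: eq_bigr => v _; case: (ok i v); rewrite ?mul1n ?mul0n.
Qed.

Lemma sum_walks1 i u l : \sum_(w <- walks i u l) 1 = wsum i l (fun=> 1) u.
Proof.
elim: l i u => [|l IHl] i u; first by rewrite big_seq1.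
by rewrite (sum_walks_recl _ _ _ (fun=> 1)) /=; apply: eq_bigr => v _; rewrite IHl.
Qed.

Lemma sum_walks_split i u l1 l2 g (phi : seq nat -> nat) :
  \sum_(w <- walks i u (l1 + l2)) (last u (take l1 w) == g) * phi (drop l1 w) =
  wnum i l1 u g * \sum_(w <- walks (i + l1) g l2) phi w.
Proof.
elim: l1 i u => [|l1 IHl1] i u.
  rewrite add0n addn0 /wnum /=; under eq_bigr do rewrite take0 drop0 /=.
  by case: eqP => [->|_]; rewrite -big_distrr.
rewrite addSn sum_walks_recl /wnum /= big_distrl /=; apply: eq_bigr => v _.
by rewrite IHl1 mulnA addSnnS.
Qed.

Variables (r s n : nat).
Hypothesis rs : r < s.
Hypothesis sn : s < n.

(** This is [G(p, g)]: a walk with prescribed heights at [r] and [s] consists of three independent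
    segments. *)
Definition walk_num p g :=
  wnum 0 r.+1 0 p * (wnum r.+1 (s - r) p g * wsum s.+1 (n - s.+1) (fun=> 1) g).

Lemma walk_numE p g :
  \sum_(w <- walks 0 0 n) ((nth 0 w r == p) && (nth 0 w s == g)) = walk_num p g.
Proof.
pose phi2 (w : seq nat) := 1.
pose phi1 (w : seq nat) := (last p (take (s - r) w) == g) * phi2 (drop (s - r) w).
have e2 := sum_walks_split r.+1 p (s - r) (n - s.+1) g phi2.
have e1 := sum_walks_split 0 0 r.+1 (s - r + (n - s.+1)) p phi1.
have en : r.+1 + (s - r + (n - s.+1)) = n by lia.
have es : r.+1 + (s - r) = s.+1 by lia.
rewrite es sum_walks1 in e2; rewrite add0n en e2 in e1; rewrite /walk_num -e1.
rewrite big_seq [RHS]big_seq; apply: eq_bigr => w /walksP[sw _ _].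
rewrite (take_nth 0) ?sw ?(ltn_trans rs) // last_rcons /phi1 /phi2 muln1.
rewrite (_ : s - r = (s - r.+1).+1); last by lia.
rewrite (take_nth 0) ?size_drop ?sw; last by lia.
rewrite last_rcons nth_drop subnKC //.
by case: eqP; case: eqP.
Qed.

Lemma walk_num_end p p' : exch p p' (walk_num p) (walk_num p').
Proof.
apply: exch_mul; first exact: exch_const.
apply: exch_mul; first exact: wnum_exch_end.
by apply: wsum_exch; exact: exch_const.
Qed.

Lemma walk_num_start g g' : exch g g' (fun p => walk_num p g) (fun p => walk_num p g').
Proof.
apply: exch_mul.
  (* Both first segments start at [0], so their exchange holds for every shift. *)
  move=> x e d _.
  by apply: (@wnum_exch_end 0 r.+1 0 0).
by apply: exch_mul; [exact: wnum_exch_start | exact: exch_const].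
Qed.

Lemma walk_num0 g : walk_num 0 g = 0.
Proof.
rewrite /walk_num wnum_recr; case: (boolP (ok _ 0)) => [/ok_pos//|_].
by rewrite !mul0n.
Qed.

Lemma walk_numW p g : W <= p -> walk_num p g = 0.
Proof.
move=> Wp; rewrite /walk_num wnum_recr.
by case: (boolP (ok _ p)) => [/okW|_]; rewrite ?mul0n // ltnNge Wp.
Qed.

Definition walk_gap (c : nat -> nat -> bool) : nat :=
  \sum_(w <- walks 0 0 n) c (nth 0 w r) (nth 0 w s).

Variable m : nat.

Lemma walk_gap_sum c (f f' : nat -> nat) :
  injective f ->
  (forall x y, (forall z, z < W -> x != f z) -> 0 < x < W -> c x y = false) ->
  (forall z y, c (f z) y = (y == f' z)) ->
  walk_gap c = \sum_(z < W) walk_num (f z) (f' z).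
Proof.
move=> injf c0 cf; under eq_bigr do rewrite -walk_numE.
rewrite exchange_big /=; rewrite /walk_gap big_seq [RHS]big_seq.
apply: eq_bigr => w /walksP[sw _ okw].
have okr := okw r (ltn_trans rs sn).
have [z /eqP wz|noz] := pickP (fun z : 'I_W => nth 0 w r == f z).
  rewrite (bigD1 z) //= wz eqxx cf /= big1 ?addn0 // => z' /negP zz'.
  by case: eqP => // /injf/val_inj/esym/eqP.
rewrite c0 ?(ok_pos okr) ?(okW okr) //; last first.
  by move=> z zW; apply/negP => wz; have := noz (Ordinal zW); rewrite /= wz.
by rewrite big1 // => z _; rewrite noz.
Qed.

Lemma walk_gap0E : walk_gap (fun x y => y == x + m) = gap_sum0 walk_num m W.
Proof.
apply: (@walk_gap_sum _ S (fun z => (z + m).+1)) => [x y []//|x y H /andP[x0 xW]|//].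
by have := H x.-1; rewrite prednK // eqxx => /(_ (ltnW xW)).
Qed.

Lemma walk_gap_predE : walk_gap (fun x y => y.+1 == x + m) = gap_sum_pred walk_num m W.
Proof.
apply: (@walk_gap_sum _ S (fun z => z + m)) => [x y []//|x y H /andP[x0 xW]|//].
by have := H x.-1; rewrite prednK // eqxx => /(_ (ltnW xW)).
Qed.

Lemma walk_gap_succE : walk_gap (fun x y => y == (x + m).+1) = gap_sum_succ walk_num m W.
Proof.
apply: (@walk_gap_sum _ id (fun z => (z + m).+1)) => [x y //|x y H /andP[x0 xW]|//].
by have := H x xW; rewrite eqxx.
Qed.

Theorem walk_gap_logconcave :
  walk_gap (fun x y => y.+1 == x + m) * walk_gap (fun x y => y == (x + m).+1) <=
  walk_gap (fun x y => y == x + m) ^ 2.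
Proof.
rewrite walk_gap0E walk_gap_predE walk_gap_succE; apply: gap_sum_logconcave.
- exact: walk_num_end.
- exact: walk_num_start.
- exact: walk_num0.
- exact: walk_numW.
Qed.

(** The height at [i] can move by one in both directions without leaving the set of walks or meeting
    a neighbouring height the wrong way; strictness says that [i] borders no flat step. *)
Definition flanked i (w : seq nat) : Prop :=
  [/\ ok i (nth 0 w i).-1, ok i (nth 0 w i).+1,
      forall j, j < i -> nth 0 w j < nth 0 w i
    & forall j, i < j < n -> nth 0 w i < nth 0 w j].

(** Heights are weakly increasing, so strictness at the adjacent positions suffices; [0 :: w]
    supplies the starting height before position [0]. *)
Lemma flankedP i w : w \in walks 0 0 n -> i < n ->
  ok i (nth 0 w i).-1 -> ok i (nth 0 w i).+1 ->
  nth 0 (0 :: w) i <> nth 0 w i ->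
  (i.+1 < n -> nth 0 w i.+1 <> nth 0 w i) -> flanked i w.
Proof.
move=> /walksP[sw pw okw] ilt okp oks Np Ns.
have mono j1 j2 : j1 <= j2 -> j2 < n -> nth 0 w j1 <= nth 0 w j2.
  move=> j12 j2n; apply: (sorted_leq_nth leq_trans leqnn) => //.
  - exact: path_sorted pw.
  - by rewrite inE sw (leq_ltn_trans j12).
  - by rewrite inE sw.
split=> // j.
  case: i ilt {okp oks Ns} Np => //= i ilt Np ji.
  by have := mono j i ji (ltnW ilt); have := mono i i.+1 (leqnSn _) ilt; lia.
move=> /andP[ij jn]; have := mono _ _ ij jn; have := mono _ _ (leqnSn i) (leq_ltn_trans ij jn).
by have := Ns (leq_ltn_trans ij jn); lia.
Qed.

(** In each alternative of [gap_sum_eq_cases] one height varies, and two of the three factors of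
    [walk_num] depend on it. Both are log-concave, so equality passes to each; strictness for
    cumulative sums then excludes a flat step on either side. *)
Theorem walk_gap_eq :
  walk_gap (fun x y => y.+1 == x + m) * walk_gap (fun x y => y == (x + m).+1) =
    walk_gap (fun x y => y == x + m) ^ 2 ->
  exists2 i, i = r \/ i = s & forall w, w \in walks 0 0 n ->
    nth 0 w s = nth 0 w r + m -> flanked i w.
Proof.
rewrite walk_gap0E walk_gap_predE walk_gap_succE => E.
have lA : logconcave (wnum 0 r.+1 0) by exact: wnum_exch_end.
have lB i l : logconcave (wsum i l (fun=> 1)) by apply: wsum_exch.
have lNe i l p : logconcave (wnum i l p) by apply/(exch_refl p); exact: wnum_exch_end.
have lNs i l g : logconcave (fun p => wnum i l p g).
  by apply/(exch_refl g); exact: wnum_exch_start.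
have seg w : w \in walks 0 0 n -> forall i l phi, i + l <= n ->
    0 < phi (nth 0 (0 :: w) (i + l)) -> 0 < wsum i l phi (nth 0 (0 :: w) i).
  move=> /walksP[sw pw okw] i l phi iln; apply: wsum_gt0 => j ij.
  have jn : j < n by lia.
  split; last exact: okw.
  by have /(pathP 0)/(_ j) := pw; rewrite sw => /(_ jn).
have := gap_sum_eq_cases walk_num_end walk_num_start walk_num0 walk_numW E.
have segD (w : seq nat) : w \in walks 0 0 n -> 0 < walk_num (nth 0 w r) (nth 0 w s).
  move=> /seg wn; rewrite !muln_gt0; apply/and3P; split.
  - by apply: (wn 0 r.+1); [lia | rewrite /= eqxx].
  - apply: (wn r.+1 (s - r)); first by lia.
    by rewrite (_ : r.+1 + (s - r) = s.+1) /= ?eqxx //; lia.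
  - by apply: (wn s.+1); lia.
case=> H; [exists s; first by right | exists r; first by left];
  move=> w wn ws; have D0 := segD w wn; have [sw pw okw] := walksP _ _ _ _ wn;
  have rpos := ok_pos (okw r (ltn_trans rs sn)); have rn := ltn_trans rs sn;
  have spos : 0 < nth 0 w s by rewrite ws addn_gt0 rpos.
- have Hr : walk_num (nth 0 w r) (nth 0 w s) ^ 2 <=
      walk_num (nth 0 w r) (nth 0 w s).-1 * walk_num (nth 0 w r) (nth 0 w s).+1.
    move: (H (nth 0 w r).-1); rewrite -addSn prednK // -ws.
    by rewrite (_ : _.-1 + m = (nth 0 w s).-1); [exact | lia].
  case E1 : (nth 0 w s) spos D0 Hr => [//|g] _; rewrite /walk_num !muln_gt0.
  move=> /and3P[A0 N0 B0] /= Hr.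
  have lN := logconcave_sq g (lNe r.+1 (s - r) (nth 0 w r)).
  have lBs := logconcave_sq g (lB s.+1 (n - s.+1)).
  (* The log-concave last factor and the constant first factor are divided out. *)
  have HN : wnum r.+1 (s - r) (nth 0 w r) g.+1 ^ 2 <=
      wnum r.+1 (s - r) (nth 0 w r) g * wnum r.+1 (s - r) (nth 0 w r) g.+2.
    apply: (@leq_of_mul _ _ (wnum 0 r.+1 0 (nth 0 w r) ^ 2 *
        wsum s.+1 (n - s.+1) (fun=> 1) g.+1 ^ 2)
      (wnum 0 r.+1 0 (nth 0 w r) ^ 2 *
        (wsum s.+1 (n - s.+1) (fun=> 1) g * wsum s.+1 (n - s.+1) (fun=> 1) g.+2)));
      last 2 first.
    - by rewrite leq_mul2l; apply/orP; right; exact: lBs.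
    - by move: Hr; rewrite !expnMn; lia.
    - by rewrite muln_gt0 !expn_gt0 A0 B0.
  have HB : wsum s.+1 (n - s.+1) (fun=> 1) g.+1 ^ 2 <=
      wsum s.+1 (n - s.+1) (fun=> 1) g * wsum s.+1 (n - s.+1) (fun=> 1) g.+2.
    apply: (@leq_of_mul _ _ (wnum 0 r.+1 0 (nth 0 w r) ^ 2 *
        wnum r.+1 (s - r) (nth 0 w r) g.+1 ^ 2)
      (wnum 0 r.+1 0 (nth 0 w r) ^ 2 *
        (wnum r.+1 (s - r) (nth 0 w r) g * wnum r.+1 (s - r) (nth 0 w r) g.+2)));
      last 2 first.
    - by rewrite leq_mul2l; apply/orP; right; exact: lN.
    - by move: Hr; rewrite !expnMn; lia.
    - by rewrite muln_gt0 !expn_gt0 A0 N0.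
  move: HN N0; rewrite (_ : s - r = (s - r.+1).+1); last by lia.
  move=> HN N0; have [Nz okp oks] := wnum_end_strict N0 HN.
  have e : r.+1 + (s - r.+1) = s by lia.
  rewrite e in okp oks; apply: flankedP => //; rewrite ?E1 //.
    (* A flat step of [w] into [s] would be counted by the number that [Nz] says is zero. *)
    move=> ws1; suff: 0 < wnum r.+1 (s - r.+1) (nth 0 (0 :: w) r.+1) g.+1.
      by rewrite /= Nz.
    by apply: seg; rewrite ?e ?ws1 ?eqxx // ltnW.
  move=> sn1 ws1; move: HB; rewrite (_ : n - s.+1 = (n - s.+2).+1); last by lia.
  have l1 : logconcave (fun=> 1) by [].
  move=> /(wsum_start_strict l1) Bz.
  have := okw _ sn1; rewrite add0n ws1 => okg; move: Bz; rewrite okg mul1n => Bz.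
  have := @seg w wn s.+2 (n - s.+2) (fun=> 1); rewrite /= ws1 Bz.
  by move=> /(_ ltac:(lia) isT).
- have Hr : walk_num (nth 0 w r) (nth 0 w s) ^ 2 <=
      walk_num (nth 0 w r).-1 (nth 0 w s) * walk_num (nth 0 w r).+1 (nth 0 w s).
    move: (H (nth 0 w r).-1); rewrite -addSn prednK // -ws; exact.
  case E1 : (nth 0 w r) rpos D0 Hr => [//|p] _; rewrite /walk_num !muln_gt0.
  move=> /and3P[A0 N0 B0] /= Hr; set g := nth 0 w s in N0 B0 Hr *.
  have lAs := logconcave_sq p lA.
  have lN := logconcave_sq p (lNs r.+1 (s - r) g).
  have HA : wnum 0 r.+1 0 p.+1 ^ 2 <= wnum 0 r.+1 0 p * wnum 0 r.+1 0 p.+2.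
    apply: (@leq_of_mul _ _ (wnum r.+1 (s - r) p.+1 g ^ 2 *
        wsum s.+1 (n - s.+1) (fun=> 1) g ^ 2)
      (wnum r.+1 (s - r) p g * wnum r.+1 (s - r) p.+2 g *
        wsum s.+1 (n - s.+1) (fun=> 1) g ^ 2)); last 2 first.
    - by rewrite leq_mul2r; apply/orP; right; exact: lN.
    - by move: Hr; rewrite !expnMn; lia.
    - by rewrite muln_gt0 !expn_gt0 N0 B0.
  have HN : wnum r.+1 (s - r) p.+1 g ^ 2 <=
      wnum r.+1 (s - r) p g * wnum r.+1 (s - r) p.+2 g.
    apply: (@leq_of_mul _ _ (wnum 0 r.+1 0 p.+1 ^ 2 *
        wsum s.+1 (n - s.+1) (fun=> 1) g ^ 2)
      (wnum 0 r.+1 0 p * wnum 0 r.+1 0 p.+2 *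
        wsum s.+1 (n - s.+1) (fun=> 1) g ^ 2)); last 2 first.
    - by rewrite leq_mul2r; apply/orP; right; exact: lAs.
    - by move: Hr; rewrite !expnMn; lia.
    - by rewrite muln_gt0 !expn_gt0 A0 B0.
  have [Az okp oks] := wnum_end_strict A0 HA.
  apply: flankedP => //; rewrite ?E1 //.
    move=> ws1; suff: 0 < wnum 0 r (nth 0 (0 :: w) 0) p.+1 by rewrite /= Az.
    by apply: seg; rewrite ?add0n ?ws1 ?eqxx // ltnW.
  move=> rn1 ws1; move: HN; rewrite (_ : s - r = (s - r.+1).+1); last by lia.
  move=> /(wsum_start_strict (logconcave_delta g)) Bz.
  have := okw _ rn1; rewrite add0n ws1 => okg; move: Bz; rewrite okg mul1n => Bz.
  have := @seg w wn r.+2 (s - r.+1) (fun v => (v == g : nat)); rewrite /= ws1 Bz.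
  rewrite (_ : r.+1 + (s - r.+1) = s) ?eqxx; last by lia.
  by move=> /(_ ltac:(lia) isT).
Qed.

End Walks.

(** * Linear extensions as lattice paths *)

Lemma card_ord_lt (n c : nat) : #|[set i : 'I_n | i < c]| = minn c n.
Proof.
rewrite -sum1dep_card; have [nc|cn] := leqP n c; last first.
  by rewrite (big_ord_narrow (ltnW cn)) sum1_card card_ord.
rewrite (eq_bigl predT) ?sum1_card ?card_ord // => i.
by rewrite (leq_trans (ltn_ord i)).
Qed.

Section LinextWalk.
Variables (d : Order.disp_t) (X : finPOrderType d) (a b : nat).
Variables (alpha : 'I_a -> X) (beta : 'I_b -> X).
Hypothesis hch : chain_partition alpha beta.

Lemma alpha_lt i i' : (alpha i < alpha i')%O = (i < i')%N.
Proof.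
case: hch => ha _ _ _; apply/idP/idP => [|/ha//]; rewrite ltnNge.
apply: contraL; rewrite leq_eqVlt => /predU1P[/val_inj->|/ha/lt_gtF->//].
by rewrite ltxx.
Qed.

Lemma beta_lt j j' : (beta j < beta j')%O = (j < j')%N.
Proof.
case: hch => _ hb _ _; apply/idP/idP => [|/hb//]; rewrite ltnNge.
apply: contraL; rewrite leq_eqVlt => /predU1P[/val_inj->|/hb/lt_gtF->//].
by rewrite ltxx.
Qed.

Lemma alpha_inj : injective alpha.
Proof.
move=> i i' e; apply: val_inj; case: (ltngtP i i') => //.
  by rewrite -alpha_lt e ltxx.
by rewrite -alpha_lt e ltxx.
Qed.

Lemma beta_inj : injective beta.
Proof.
move=> i i' e; apply: val_inj; case: (ltngtP i i') => //.
  by rewrite -beta_lt e ltxx.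
by rewrite -beta_lt e ltxx.
Qed.

Lemma alpha_beta i j : alpha i <> beta j.
Proof. by move=> e; case: hch => _ _ _ /(_ (alpha i)); rewrite codom_f e codom_f; case. Qed.

Lemma chain_cover u : (exists i, u = alpha i) \/ (exists j, u = beta j).
Proof.
case: hch => _ _ /(_ u) [] /codomP[i ->] _; [left|right]; by exists i.
Qed.

Lemma sum_chains (f : X -> nat) :
  \sum_u f u = \sum_i f (alpha i) + \sum_j f (beta j).
Proof.
rewrite (bigID (mem (codom alpha))) /=; congr (_ + _).
  rewrite -big_uniq ?big_map ?big_enum //=.
  by rewrite map_inj_uniq ?enum_uniq //; exact: alpha_inj.
rewrite (eq_bigl (mem (codom beta))).
  rewrite -big_uniq ?big_map ?big_enum //=.
  by rewrite map_inj_uniq ?enum_uniq //; exact: beta_inj.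
move=> u; case: hch => _ _ /(_ u) h1 /(_ u) h2 /=.
by apply/idP/idP => [|ub]; [case: h1 => ->|apply/negP => ua; apply: h2].
Qed.

Lemma card_chains : #|X| = a + b.
Proof. by rewrite -sum1_card sum_chains !sum1_card !card_ord. Qed.

Definition below (L : {ffun X -> 'I_#|X|}) u := #|[set j : 'I_b | L (beta j) < L u]|.

Definition heights (L : {ffun X -> 'I_#|X|}) : seq nat :=
  [seq (below L (alpha i)).+1 | i <- enum 'I_a].

Lemma nth_heights L (i : 'I_a) : nth 0 (heights L) i = (below L (alpha i)).+1.
Proof. by rewrite (nth_map i) ?size_enum_ord // nth_ord_enum. Qed.

Section OneLinext.
Variable L : {ffun X -> 'I_#|X|}.
Hypothesis linL : is_linext L.

Let bijL : bijective L. Proof. by case/is_linextP: linL. Qed.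
Let homL u v : (u < v)%O -> L u < L v.
Proof. by case/is_linextP: linL => _ H /H. Qed.

(** [L] is onto the positions, so [L u] counts the elements placed before [u], chain by chain. *)
Lemma linext_posE u : L u = #|[set i : 'I_a | L (alpha i) < L u]| + below L u :> nat.
Proof.
have E : \sum_v (L v < L u : nat) = L u.
  have [g Lg gL] := bijL.
  rewrite (reindex g); last by exists L => x _; rewrite ?Lg ?gL.
  under eq_bigr => x _ do rewrite gL.
  by rewrite -big_mkcond /= sum1dep_card card_ord_lt (minn_idPl (ltnW (ltn_ord _))).
by rewrite -[LHS]E sum_chains /below -!sum1dep_card; congr (_ + _); rewrite [RHS]big_mkcond.
Qed.

Lemma linext_alpha_lt (i i' : 'I_a) : (L (alpha i) < L (alpha i')) = (i < i').
Proof.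
case: (ltngtP i i') => [||/val_inj->]; rewrite ?ltnn //.
  by rewrite -alpha_lt => /homL ->.
by rewrite -alpha_lt => /homL H; apply/negbTE; rewrite -leqNgt ltnW.
Qed.

Lemma linext_beta_lt (i i' : 'I_b) : (L (beta i) < L (beta i')) = (i < i').
Proof.
case: (ltngtP i i') => [||/val_inj->]; rewrite ?ltnn //.
  by rewrite -beta_lt => /homL ->.
by rewrite -beta_lt => /homL H; apply/negbTE; rewrite -leqNgt ltnW.
Qed.

(** The elements of the second chain placed before [alpha i] form an initial segment, so their
    number decides each comparison. *)
Lemma below_leq (i : 'I_a) (j : 'I_b) : (below L (alpha i) <= j) = (L (alpha i) < L (beta j)).
Proof.
have [ij|ji] := ltnP (L (alpha i)) (L (beta j)).
  have := card_ord_lt b j; rewrite (minn_idPl (ltnW (ltn_ord j))) => <-.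
  apply: subset_leq_card; apply/subsetP => j'; rewrite !inE => j'i.
  by rewrite -linext_beta_lt; apply: ltn_trans ij.
apply/negbTE; rewrite -ltnNge.
have := card_ord_lt b j.+1; rewrite (minn_idPl (ltn_ord j)) => <-.
apply: subset_leq_card; apply/subsetP => j'; rewrite !inE ltnS => j'j.
have : L (beta j) < L (alpha i).
  rewrite ltn_neqAle ji andbT; apply/eqP => /val_inj e.
  by apply: (@alpha_beta i j); apply: (bij_inj bijL).
apply: leq_ltn_trans; move: j'j; rewrite leq_eqVlt => /predU1P[/val_inj->//|].
by rewrite -linext_beta_lt => /ltnW.
Qed.

Lemma linext_alphaE i : L (alpha i) = i + below L (alpha i) :> nat.
Proof.
rewrite linext_posE; congr (_ + _).
rewrite -[RHS](minn_idPl (ltnW (ltn_ord i))) -card_ord_lt.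
by apply: eq_card => i'; rewrite !inE linext_alpha_lt.
Qed.

Lemma linext_betaE j :
  L (beta j) = #|[set i : 'I_a | below L (alpha i) <= j]| + j :> nat.
Proof.
rewrite linext_posE; congr (_ + _).
  by apply: eq_card => i'; rewrite !inE below_leq.
rewrite -[RHS](minn_idPl (ltnW (ltn_ord j))) -card_ord_lt.
by apply: eq_card => i'; rewrite !inE linext_beta_lt.
Qed.

Lemma below_le i : below L (alpha i) <= b.
Proof. by rewrite -[leqRHS]card_ord max_card. Qed.

Lemma below_mono (i i' : 'I_a) : i <= i' -> below L (alpha i) <= below L (alpha i').
Proof.
move=> ii'; apply: subset_leq_card; apply/subsetP => j; rewrite !inE => ji.
apply: leq_trans ji _; move: ii'; rewrite leq_eqVlt => /predU1P[/val_inj->//|].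
by rewrite -linext_alpha_lt => /ltnW.
Qed.

End OneLinext.

(* [v] is an admissible value of [(heights L)`_i]: the [v - 1] lowest elements
   of the second chain may precede [alpha i], and the others follow it.  The
   shift by one makes [0] inadmissible. *)
Definition admissible (i : nat) : pred nat := fun v =>
  [&& 0 < v, v < b.+2 & [forall i' : 'I_a, forall j : 'I_b, (i' == i :> nat) ==>
     ((beta j < alpha i')%O ==> (j.+1 < v)) && ((alpha i' < beta j)%O ==> (v <= j.+1))]].

Lemma admissibleP (i : 'I_a) v : reflect
  [/\ 0 < v, v < b.+2, forall j : 'I_b, (beta j < alpha i)%O -> j.+1 < v
    & forall j : 'I_b, (alpha i < beta j)%O -> v <= j.+1]
  (admissible i v).
Proof.
apply: (iffP and3P) => [[v0 vb /forallP/(_ i)/forallP H]|[v0 vb h1 h2]].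
  by split=> // j ij; move: (H j); rewrite eqxx ij /= => /andP[].
split=> //; apply/forallP => i'; apply/forallP => j; apply/implyP => /eqP/val_inj->.
by apply/andP; split; apply/implyP; [exact: h1 | exact: h2].
Qed.

Lemma admissible_lt i v : admissible i v -> v < b.+2.
Proof. by case/and3P. Qed.

Lemma admissible_gt0 i v : admissible i v -> 0 < v.
Proof. by case/and3P. Qed.

Lemma admissible_conv i x y z :
  x <= y <= z -> admissible i x -> admissible i z -> admissible i y.
Proof.
move=> /andP[xy yz] /and3P[x0 xb /forallP hx] /and3P[z0 zb /forallP hz].
apply/and3P; split; rewrite ?(leq_trans x0) ?(leq_ltn_trans yz) //.
apply/forallP => i'; apply/forallP => j; apply/implyP => ii'.
move/forallP/(_ j): (hx i'); move/forallP/(_ j): (hz i'); rewrite ii' /=.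
move=> /andP[_ h1] /andP[h2 _].
apply/andP; split; apply/implyP => h.
  by move: h2; rewrite h /= => h2; exact: leq_trans xy.
by move: h1; rewrite h /= => h1; exact: leq_trans h1.
Qed.

Notation hwalks := (walks admissible b.+2 0 0 a).
Let hwalksP := walksP admissible_lt.

Lemma heights_walk L : is_linext L -> heights L \in hwalks.
Proof.
move=> linL; apply/hwalksP; split.
- by rewrite size_map size_enum_ord.
- apply/(pathP 0) => -[|i] //; rewrite size_map size_enum_ord => ia /=.
  rewrite (nth_heights L (Ordinal ia)) (nth_heights L (Ordinal (ltnW ia))) ltnS.
  exact: below_mono.
- move=> i ia; rewrite add0n (nth_heights L (Ordinal ia)).
  apply/(admissibleP (Ordinal ia)); split=> // [|j|j].
  + by rewrite ltnS ltnS below_le.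
  + move=> /(proj2 (is_linextP _ linL)); rewrite /label ltnS => h.
    by rewrite ltnS ltnNge below_leq // -leqNgt ltnW.
  + by move=> /(proj2 (is_linextP _ linL)); rewrite ltnS ltnS below_leq.
Qed.

Lemma heights_inj : {in is_linext (X := X) &, injective heights}.
Proof.
move=> L L' linL linL' e.
have eb i : below L (alpha i) = below L' (alpha i).
  by apply: succn_inj; rewrite -!nth_heights e.
apply/ffunP => u; apply: val_inj => /=; case: (chain_cover u) => -[i ->].
  by rewrite !linext_alphaE // eb.
rewrite !linext_betaE //; congr (_ + _).
by apply: eq_card => i'; rewrite !inE eb.
Qed.

Section OfWalk.
Variable w : seq nat.
Hypothesis ww : w \in hwalks.

Let h (i : 'I_a) := (nth 0 w i).-1.

Let adm (i : 'I_a) : admissible i (h i).+1.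
Proof.
have [_ _ /(_ i (ltn_ord i))] := hwalksP _ _ _ _ ww.
by rewrite add0n => ok; rewrite prednK //; exact: admissible_gt0 ok.
Qed.

Let hmono (i i' : 'I_a) : i <= i' -> h i <= h i'.
Proof.
have [sw pw _] := hwalksP _ _ _ _ ww; move=> ii'.
rewrite /h -!subn1 leq_sub2r //.
by apply: (sorted_leq_nth leq_trans leqnn 0 (path_sorted pw)) => //; rewrite inE sw.
Qed.

Let ncnt (j : 'I_b) := #|[set i : 'I_a | h i <= j]|.

(** The inverse of [heights]: positions as prescribed by [linext_alphaE] and [linext_betaE]. The
    chains cover [X], so the default [0] is never reached. *)
Definition walk_pos u : nat :=
  if [pick i | alpha i == u] is Some i then i + h i
  else if [pick j | beta j == u] is Some j then ncnt j + j else 0.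

Lemma walk_pos_alpha i : walk_pos (alpha i) = i + h i.
Proof.
by rewrite /walk_pos; case: pickP => [i' /eqP/alpha_inj->//|/(_ i)]; rewrite eqxx.
Qed.

Lemma walk_pos_beta j : walk_pos (beta j) = ncnt j + j.
Proof.
rewrite /walk_pos; case: pickP => [i /eqP/alpha_beta//|_].
by case: pickP => [i' /eqP/beta_inj->//|/(_ j)]; rewrite eqxx.
Qed.

Let ncnt_leq (i : 'I_a) (j : 'I_b) : h i <= j -> i < ncnt j.
Proof.
move=> hij; have := card_ord_lt a i.+1; rewrite (minn_idPl (ltn_ord i)) => {1}<-.
apply: subset_leq_card; apply/subsetP => i'; rewrite !inE ltnS => i'i.
exact: leq_trans (hmono i'i) hij.
Qed.

Let ncnt_gt (i : 'I_a) (j : 'I_b) : j < h i -> ncnt j <= i.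
Proof.
move=> hij; have := card_ord_lt a i; rewrite (minn_idPl (ltnW (ltn_ord i))) => <-.
apply: subset_leq_card; apply/subsetP => i'; rewrite !inE => i'j.
by rewrite ltnNge; apply/negP => /hmono; lia.
Qed.

Let ncnt_mono (j j' : 'I_b) : j <= j' -> ncnt j <= ncnt j'.
Proof.
move=> jj'; apply: subset_leq_card; apply/subsetP => i; rewrite !inE => hi.
exact: leq_trans jj'.
Qed.

Lemma walk_pos_alpha_beta i j : (walk_pos (alpha i) < walk_pos (beta j)) = (h i <= j).
Proof.
rewrite walk_pos_alpha walk_pos_beta; have [hij|hij] := leqP (h i) j.
  by have := ncnt_leq hij; lia.
by have := ncnt_gt hij; lia.
Qed.

Lemma walk_pos_beta_alpha i j : (walk_pos (beta j) < walk_pos (alpha i)) = (j < h i).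
Proof.
rewrite walk_pos_alpha walk_pos_beta; have [hij|hij] := ltnP j (h i).
  by have := ncnt_gt hij; lia.
by have := ncnt_leq hij; lia.
Qed.

Lemma walk_pos_bound u : walk_pos u < #|X|.
Proof.
rewrite card_chains; case: (chain_cover u) => -[i ->].
  rewrite walk_pos_alpha -addSn leq_add //.
  by have /admissibleP[_ ?] := adm i.
by rewrite walk_pos_beta -addnS leq_add // -[leqRHS]card_ord max_card.
Qed.

Definition linext_of_walk : {ffun X -> 'I_#|X|} := [ffun u => Ordinal (walk_pos_bound u)].

Lemma walk_pos_hom u v : (u < v)%O -> walk_pos u < walk_pos v.
Proof.
case: (chain_cover u) => -[i ->]; case: (chain_cover v) => -[j ->].
- by rewrite alpha_lt !walk_pos_alpha => ij; have := hmono (ltnW ij); lia.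
- by rewrite walk_pos_alpha_beta; have /admissibleP[_ _ _ H] := adm i; move=> /H.
- by rewrite walk_pos_beta_alpha; have /admissibleP[_ _ H _] := adm j; move=> /H.
- by rewrite beta_lt !walk_pos_beta => ij; have := ncnt_mono (ltnW ij); lia.
Qed.

Lemma walk_pos_inj : injective walk_pos.
Proof.
move=> u v; case: (chain_cover u) => -[i ->]; case: (chain_cover v) => -[j ->] e.
- congr alpha; apply: val_inj; case: (ltngtP i j) => //;
    by rewrite -alpha_lt => /walk_pos_hom; rewrite e ltnn.
- by have := walk_pos_alpha_beta i j; have := walk_pos_beta_alpha i j; rewrite e ltnn; lia.
- by have := walk_pos_alpha_beta j i; have := walk_pos_beta_alpha j i; rewrite e ltnn; lia.
- congr beta; apply: val_inj; case: (ltngtP i j) => //;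
    by rewrite -beta_lt => /walk_pos_hom; rewrite e ltnn.
Qed.

Lemma linext_of_walk_linext : is_linext linext_of_walk.
Proof.
apply/is_linextP; split.
  apply: inj_card_bij; last by rewrite card_ord.
  by move=> u v; rewrite !ffunE => /(congr1 val)/=/walk_pos_inj.
by move=> u v uv; rewrite /label !ffunE ltnS; exact: walk_pos_hom.
Qed.

Lemma heights_of_walk : heights linext_of_walk = w.
Proof.
have [sw _ _] := hwalksP _ _ _ _ ww.
apply: (@eq_from_nth _ 0); first by rewrite size_map size_enum_ord.
move=> i; rewrite size_map size_enum_ord => ia.
rewrite (nth_heights _ (Ordinal ia)) /below.
have /admissibleP[_ hb _ _] := adm (Ordinal ia).
have -> : [set j | linext_of_walk (beta j) < linext_of_walk (alpha (Ordinal ia))] =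
    [set j : 'I_b | j < h (Ordinal ia)].
  by apply/setP => j; rewrite !inE !ffunE /= walk_pos_beta_alpha.
rewrite card_ord_lt (minn_idPl _) // prednK //.
have [_ _ /(_ i ia)] := hwalksP _ _ _ _ ww; exact: admissible_gt0.
Qed.

End OfWalk.

Lemma sum_linexts (f : seq nat -> nat) :
  \sum_(L : {ffun X -> 'I_#|X|} | is_linext L) f (heights L) = \sum_(w <- hwalks) f w.
Proof.
transitivity (\sum_(L <- enum (is_linext (X := X))) f (heights L)).
  by rewrite big_enum.
rewrite -(big_map heights predT f); apply: perm_big; apply: uniq_perm; last 1 first.
- move=> w; apply/mapP/idP => [[L]|ww].
    by rewrite mem_enum => linL ->; exact: heights_walk.
  exists (linext_of_walk ww); last by rewrite heights_of_walk.
  by rewrite mem_enum; exact: linext_of_walk_linext.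
- rewrite map_inj_in_uniq ?enum_uniq // => L L'; rewrite !mem_enum.
  exact: heights_inj.
- exact: walks_uniq.
Qed.

End LinextWalk.

(** * Gap counts of linear extensions as walk counts *)

Section GapCount.
Variables (d : Order.disp_t) (X : finPOrderType d) (a b : nat).
Variables (alpha : 'I_a -> X) (beta : 'I_b -> X).
Hypothesis hch : chain_partition alpha beta.

Notation hgap := (walk_gap (admissible alpha beta) b.+2).

(** The shift to 1-based labels is absorbed by the shift of the heights. *)
Lemma label_alpha L i : is_linext L ->
  label L (alpha i) = i + nth 0 (heights alpha beta L) i.
Proof. by move=> linL; rewrite nth_heights /label (linext_alphaE hch linL) addnS. Qed.

Lemma F_alphaE (r s : 'I_a) (j : int) : F (alpha r) (alpha s) j =
  hgap r s a (fun v v' => ((s + v')%:Z - (r + v)%:Z == j)%R).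
Proof.
rewrite /F /linexts_gap -sum1dep_card /walk_gap.
rewrite -(sum_linexts hch (fun w => ((s + nth 0 w s)%:Z - (r + nth 0 w r)%:Z == j)%R)).
rewrite big_mkcondr /=; apply: eq_bigr => L linL.
by rewrite !label_alpha //; case: eqP.
Qed.

Lemma eq_walk_gap r s n c c' : c =2 c' -> hgap r s n c = hgap r s n c'.
Proof. by move=> cc'; apply: eq_bigr => w _; rewrite cc'. Qed.

Lemma flanked_neighbours L (i : 'I_a) : is_linext L ->
  flanked (admissible alpha beta) a i (heights alpha beta L) ->
  exists u v : X, [/\ (u >< alpha i)%O, (v >< alpha i)%O,
    (label L u).+1 = label L (alpha i) & label L v = (label L (alpha i)).+1].
Proof.
move=> linL [].
rewrite !nth_heights /= => /admissibleP[g0 gb h1 h2] /admissibleP[_ gb' h3 h4] lt gt.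
have [_ _] := walksP (@admissible_lt _ _ _ _ alpha beta) _ _ _ _ (heights_walk hch linL).
move=> /(_ i (ltn_ord i)); rewrite add0n nth_heights => /admissibleP[_ _ h5 h6].
set g := below beta L (alpha i) in lt gt g0 gb h1 h2 gb' h3 h4 h5 h6 *.
have lt' (i' : 'I_a) : i' < i -> below beta L (alpha i') < g.
  by move=> i'i; have := lt i' i'i; rewrite nth_heights.
have gt' (i' : 'I_a) : i < i' -> g < below beta L (alpha i').
  by move=> i'i; have := gt i'; rewrite nth_heights i'i ltn_ord; apply.
(* The first [g] elements of the second chain precede [alpha i], so its neighbours are [beta] at
   [g.-1] and [g]. Admissibility of the heights [g] and [g.+2] makes them incomparable to it, and
   strictness keeps other [alpha] elements from coming between. *)
have jb : g.-1 < b by lia.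
have j'b : g < b by lia.
have La : label L (alpha i) = i + g.+1 by rewrite label_alpha // nth_heights.
exists (beta (Ordinal jb)), (beta (Ordinal j'b)); split.
- apply/negP => /comparable_ltgtP; case.
  + by move=> /h1 /=; lia.
  + by move=> /h6 /=; lia.
  + by move/esym/(alpha_beta hch).
- apply/negP => /comparable_ltgtP; case.
  + by move=> /h5 /=; lia.
  + by move=> /h4 /=; lia.
  + by move/esym/(alpha_beta hch).
- rewrite La /label (linext_betaE hch linL) /=.
  have -> : [set i' : 'I_a | below beta L (alpha i') <= g.-1] = [set i' : 'I_a | i' < i].
    apply/setP => i'; rewrite !inE; case: (ltngtP i' i) => [/lt'|/gt'|/val_inj->].
    + by lia.
    + by lia.
    + by rewrite -/g; lia.
  by rewrite card_ord_lt (minn_idPl (ltnW (ltn_ord i))); lia.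
- rewrite La /label (linext_betaE hch linL) /=.
  have -> : [set i' : 'I_a | below beta L (alpha i') <= g] = [set i' : 'I_a | i' < i.+1].
    apply/setP => i'; rewrite !inE ltnS; case: (ltngtP i' i) => [/lt'|/gt'|/val_inj->].
    + by lia.
    + by lia.
    + by rewrite -/g leqnn.
  by rewrite card_ord_lt (minn_idPl (ltn_ord i)); lia.
Qed.

Section Alpha.
Variables (r s : 'I_a) (k : int).
Hypothesis rs : r < s.
Hypothesis Fk : 0 < F (alpha r) (alpha s) k.

Lemma gap_offset : exists m : nat, k = (s%:Z - r%:Z + m%:Z)%R.
Proof.
move: Fk; rewrite card_gt0 => /set0Pn[L]; rewrite inE => /andP[linL /eqP <-].
rewrite !label_alpha // !nth_heights.
have := below_mono hch linL (ltnW rs : r <= s).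
set p := below _ _ _; set g := below _ _ _ => pg; exists (g - p); lia.
Qed.

(** The gap [k - 1] is expressed by [v'.+1 == v + m], because [m] may be [0]. *)
Let gapE (m : nat) : k = (s%:Z - r%:Z + m%:Z)%R ->
  [/\ F (alpha r) (alpha s) (k - 1)%R = hgap r s a (fun v v' => v'.+1 == v + m),
      F (alpha r) (alpha s) k = hgap r s a (fun v v' => v' == v + m)
    & F (alpha r) (alpha s) (k + 1)%R = hgap r s a (fun v v' => v' == (v + m).+1)].
Proof.
by move=> ->; split; rewrite F_alphaE; apply: eq_walk_gap => v v'; apply/eqP/eqP; lia.
Qed.

Theorem F_alpha_logconcave :
  F (alpha r) (alpha s) (k - 1)%R * F (alpha r) (alpha s) (k + 1)%R
    <= F (alpha r) (alpha s) k ^ 2.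
Proof.
have [m /gapE[-> -> ->]] := gap_offset.
apply: walk_gap_logconcave => //.
- exact: admissible_lt.
- exact: admissible_gt0.
- exact: admissible_conv.
Qed.

Theorem F_alpha_eq :
  F (alpha r) (alpha s) k ^ 2 =
    F (alpha r) (alpha s) (k - 1)%R * F (alpha r) (alpha s) (k + 1)%R ->
  exists z : X, (z = alpha r \/ z = alpha s) /\
    forall L, L \in linexts_gap (alpha r) (alpha s) k ->
      exists u v : X, [/\ (u >< z)%O, (v >< z)%O,
        (label L u).+1 = label L z & label L v = (label L z).+1].
Proof.
have [m km] := gap_offset; have [-> -> ->] := gapE km; move=> /esym E.
have [i irs H] := walk_gap_eq (@admissible_lt _ _ _ _ alpha beta)
  (@admissible_gt0 _ _ _ _ alpha beta) (@admissible_conv _ _ _ _ alpha beta) rs (ltn_ord s) E.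
have [i' ii' irs'] : exists2 i' : 'I_a, i = i' :> nat & i' = r \/ i' = s.
  by case: irs => ->; [exists r => //; left | exists s => //; right].
exists (alpha i'); split; first by case: irs' => ->; [left | right].
move=> L; rewrite inE => /andP[linL /eqP gapL].
apply: flanked_neighbours => //; rewrite -ii'; apply: H; first exact: heights_walk.
by move: gapL; rewrite !label_alpha // km; lia.
Qed.
End Alpha.
End GapCount.

(** * Exchanging adjacent elements *)

Section Swap.
Variables (d : Order.disp_t) (X : finPOrderType d).
Implicit Type L : {ffun X -> 'I_#|X|}.

(* Exchanges the labels of [z] and of the element whose position is [o (L z)];
   acting on positions makes injectivity in [L] immediate. *)
Definition swap_pos (o : 'I_#|X| -> 'I_#|X|) (z : X) L : {ffun X -> 'I_#|X|} :=
  [ffun w => tperm (L z) (o (L z)) (L w)].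

Lemma swap_pos_inj o z : injective o -> injective (swap_pos o z).
Proof.
move=> injo L1 L2 e; have := congr1 (fun f : {ffun _ -> _} => f z) e.
rewrite !ffunE !tpermL => /injo Lz; apply/ffunP => w.
have := congr1 (fun f : {ffun _ -> _} => f w) e.
by rewrite !ffunE Lz => /perm_inj.
Qed.

Lemma linext_inj L : is_linext L -> injective L.
Proof. by case/is_linextP => /bij_inj. Qed.

Lemma swap_posE o L z u w : is_linext L -> o (L z) = L u ->
  swap_pos o z L w = L (tperm z u w).
Proof. by move=> /linext_inj injL e; rewrite ffunE e inj_tperm. Qed.

(** No label lies between those of [u] and [z], so only the order of this incomparable pair
    changes. *)
Lemma swap_pos_linext o L z u : is_linext L -> o (L z) = L u -> (u >< z)%O ->
  L u = (L z).+1 :> nat \/ L z = (L u).+1 :> nat -> is_linext (swap_pos o z L).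
Proof.
move=> linL e uz adj; have injL := linext_inj linL.
have homL v v' : (v < v')%O -> L v < L v' by case/is_linextP: linL => _ H /H.
have neq v v' : v <> v' -> L v <> L v' :> nat by move=> vv' /val_inj/injL.
have zu : ~ (z < u)%O by move=> h; move: uz; rewrite /Order.comparable (ltW h) orbT.
have uz' : ~ (u < z)%O by move=> h; move: uz; rewrite /Order.comparable (ltW h).
apply/is_linextP; split.
  apply: inj_card_bij; last by rewrite card_ord.
  by move=> v v'; rewrite !(swap_posE _ linL e) => /injL/perm_inj.
move=> v v' vv'; rewrite /label !(swap_posE _ linL e) ltnS.
have Lvv' := homL _ _ vv'.
case: tpermP => [vz|vu|vz vu]; case: tpermP => [v'z|v'u|v'z v'u]; subst => //.
- by rewrite ltxx in vv'.
- by have := neq _ _ v'u; lia.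
- by rewrite ltxx in vv'.
- by have := neq _ _ v'z; lia.
- by have := neq _ _ vu; lia.
- by have := neq _ _ vz; lia.
Qed.

Variables (a : nat) (alpha : 'I_a -> X).
Hypothesis alpha_mono : forall i j : 'I_a, i < j -> (alpha i < alpha j)%O.

Let injalpha : injective alpha.
Proof.
move=> i j e; apply: val_inj; case: (ltngtP i j) => // /alpha_mono;
  by rewrite e ltxx.
Qed.

Let alpha_comparable i j : (alpha i >=< alpha j)%O.
Proof.
case: (ltngtP i j) => [/alpha_mono/lt_comparable//||/val_inj->]; last exact: comparablexx.
by move=> /alpha_mono/lt_comparable; rewrite comparable_sym.
Qed.

(** Being incomparable to [z], the element [u] is not in the chain, so only the summand of [z]
    changes. *)
Lemma wgt_swap_in L L' z u : z \in codom alpha -> (u >< z)%O ->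
  (forall w, L' w = L (tperm z u w)) -> wgt alpha L' + label L z = wgt alpha L + label L u.
Proof.
case/codomP => i -> ui E; rewrite /wgt (bigD1 i) //= [X in _ = X + _](bigD1 i) //=.
rewrite {1}/label E tpermL -/(label L u).
rewrite (eq_bigr (fun j => label L (alpha j))); first by lia.
move=> j ji; rewrite /label E tpermD //; first by rewrite (inj_eq injalpha) eq_sym.
by apply: contraNneq ui => ->; exact: alpha_comparable.
Qed.

Lemma wgt_swap_out L L' z u : u \in codom alpha -> (u >< z)%O ->
  (forall w, L' w = L (tperm z u w)) -> wgt alpha L' + label L u = wgt alpha L + label L z.
Proof.
move=> ua uz E; apply: wgt_swap_in => //; first by rewrite comparable_sym.
by move=> w; rewrite E tpermC.
Qed.

Variables (x y : X).

Lemma F_leq_inj j j' f : injective f ->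
  {in linexts_gap x y j, forall L, f L \in linexts_gap x y j'} -> F x y j <= F x y j'.
Proof.
move=> injf H; rewrite /F -(card_imset _ injf); apply: subset_leq_card.
by apply/subsetP => L' /imsetP[L /H ? ->].
Qed.

(** By cardinality the injection is onto, so it reindexes the sum. *)
Lemma Fq_inj j j' f : injective f ->
  {in linexts_gap x y j, forall L, f L \in linexts_gap x y j'} -> F x y j' <= F x y j ->
  Fq alpha x y j' = (\sum_(L in linexts_gap x y j) 'X^(wgt alpha (f L)))%R.
Proof.
move=> injf H le; rewrite /Fq.
have -> : linexts_gap x y j' = f @: linexts_gap x y j.
  apply/esym/eqP; rewrite eqEcard card_imset // le andbT.
  by apply/subsetP => L' /imsetP[L /H ? ->].
by rewrite big_imset //= => L L' _ _; exact: injf.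
Qed.

Lemma Fq_inj_succ j j' f : injective f ->
  {in linexts_gap x y j, forall L, f L \in linexts_gap x y j'} -> F x y j' <= F x y j ->
  {in linexts_gap x y j, forall L, wgt alpha (f L) = (wgt alpha L).+1} ->
  Fq alpha x y j' = ('X * Fq alpha x y j)%R.
Proof.
move=> injf H le wf; rewrite (Fq_inj injf H le) /Fq mulr_sumr.
by apply: eq_bigr => L /wf ->; rewrite exprS.
Qed.

Lemma Fq_inj_pred j j' f : injective f ->
  {in linexts_gap x y j, forall L, f L \in linexts_gap x y j'} -> F x y j' <= F x y j ->
  {in linexts_gap x y j, forall L, (wgt alpha (f L)).+1 = wgt alpha L} ->
  Fq alpha x y j = ('X * Fq alpha x y j')%R.
Proof.
move=> injf H le wf; rewrite (Fq_inj injf H le) /Fq mulr_sumr.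
by apply: eq_bigr => L /wf <-; rewrite exprS.
Qed.

End Swap.

(** * Consequences of the neighbour condition (e) *)

Section Neighbours.
Variables (d : Order.disp_t) (X : finPOrderType d) (a b : nat).
Variables (alpha : 'I_a -> X) (beta : 'I_b -> X).
Hypothesis hch : chain_partition alpha beta.
Implicit Type L : {ffun X -> 'I_#|X|}.

Lemma incomparable_codom u z : (u >< z)%O -> z \notin codom alpha -> u \in codom alpha.
Proof.
move=> uz za; case: hch => _ hb cov _.
have /codomP[j zj] : z \in codom beta by case: (cov z) => // zin; rewrite zin in za.
case: (cov u) => // /codomP[i ui]; move: uz; rewrite zj ui => /negP[].
case: (ltngtP i j) => [/hb/lt_comparable//|/hb/lt_comparable|/val_inj->].
  by rewrite comparable_sym.
exact: comparablexx.
Qed.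

Lemma swap_posP o L z u : is_linext L -> o (L z) = L u -> (u >< z)%O ->
  L u = (L z).+1 :> nat \/ L z = (L u).+1 :> nat ->
  [/\ is_linext (swap_pos o z L), label (swap_pos o z L) z = label L u,
      forall w, w != z -> (w >=< z)%O -> label (swap_pos o z L) w = label L w,
      z \in codom alpha ->
        wgt alpha (swap_pos o z L) + label L z = wgt alpha L + label L u
    & z \notin codom alpha ->
        wgt alpha (swap_pos o z L) + label L u = wgt alpha L + label L z].
Proof.
move=> linL e uz adj; have E w := swap_posE w linL e; case: (hch) => ha _ _ _.
split.
- exact: swap_pos_linext e uz adj.
- by rewrite /label E tpermL.
- move=> w wz wcz; rewrite /label E tpermD //; first by rewrite eq_sym.
  by apply: contraTneq wcz => <-.
- by move=> za; exact: (wgt_swap_in ha za uz E).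
- by move=> za; apply: (wgt_swap_out ha (incomparable_codom uz za) uz E).
Qed.

Lemma swap_down L z u : is_linext L -> (u >< z)%O -> (label L u).+1 = label L z ->
  let L' := swap_pos (@ord_pred _) z L in
  [/\ is_linext L', (label L' z).+1 = label L z,
      forall w, w != z -> (w >=< z)%O -> label L' w = label L w,
      z \in codom alpha -> (wgt alpha L').+1 = wgt alpha L
    & z \notin codom alpha -> wgt alpha L' = (wgt alpha L).+1].
Proof.
move=> linL uz [e]; have {}e : (L u).+1 = L z :> nat := e.
(* [ord_pred] is cyclic, hence bijective; it does not wrap around here, as [L z] is a successor. *)
have eo : ord_pred (L z) = L u.
  by apply: val_inj; rewrite /= -e addSn /= modnDr modn_small.
have [|h1 h2 h3 h4 h5] := swap_posP linL eo uz; first by right.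
split=> //; first by rewrite h2 /label e.
  by move/h4; rewrite /label -e; lia.
by move/h5; rewrite /label -e; lia.
Qed.

Lemma swap_up L z v : is_linext L -> (v >< z)%O -> label L v = (label L z).+1 ->
  let L' := swap_pos (@ordS _) z L in
  [/\ is_linext L', label L' z = (label L z).+1,
      forall w, w != z -> (w >=< z)%O -> label L' w = label L w,
      z \in codom alpha -> wgt alpha L' = (wgt alpha L).+1
    & z \notin codom alpha -> (wgt alpha L').+1 = wgt alpha L].
Proof.
move=> linL vz [e]; have {}e : L v = (L z).+1 :> nat := e.
have eo : ordS (L z) = L v.
  by apply: val_inj; rewrite /= -e modn_small.
have [|h1 h2 h3 h4 h5] := swap_posP linL eo vz; first by left.
split=> //; first by rewrite h2 /label e.
  by move/h4; rewrite /label e; lia.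
by move/h5; rewrite /label e; lia.
Qed.

Variables (x y : X) (k : int).
Hypothesis xy : (x < y)%O.
Hypothesis Fk : 0 < F x y k.
Hypothesis lc : F x y (k - 1)%R * F x y (k + 1)%R <= F x y k ^ 2.

Definition neighbours_at z := forall L, L \in linexts_gap x y k ->
  exists u v : X, [/\ (u >< z)%O, (v >< z)%O,
    (label L u).+1 = label L z & label L v = (label L z).+1].

(** Conditions (b) and (d), the latter without inverse powers of [q]: the first alternative is
    [eps = -1], the second [eps = 1]. *)
Definition gap_conclusion : Prop :=
  (F x y k = F x y (k + 1)%R /\ F x y (k + 1)%R = F x y (k - 1)%R) /\
  ((Fq alpha x y (k - 1) = 'X * Fq alpha x y k /\
    Fq alpha x y k = 'X * Fq alpha x y (k + 1))%R \/
   (Fq alpha x y k = 'X * Fq alpha x y (k - 1) /\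
    Fq alpha x y (k + 1) = 'X * Fq alpha x y k)%R).

Lemma gap_conclusionP (f g : {ffun X -> 'I_#|X|} -> {ffun X -> 'I_#|X|}) :
  injective f -> injective g ->
  {in linexts_gap x y k, forall L, f L \in linexts_gap x y (k - 1)%R} ->
  {in linexts_gap x y k, forall L, g L \in linexts_gap x y (k + 1)%R} ->
  {in linexts_gap x y k, forall L, wgt alpha (f L) = (wgt alpha L).+1 /\
     (wgt alpha (g L)).+1 = wgt alpha L} \/
  {in linexts_gap x y k, forall L, (wgt alpha (f L)).+1 = wgt alpha L /\
     wgt alpha (g L) = (wgt alpha L).+1} ->
  gap_conclusion.
Proof.
move=> injf injg fk gk wfg.
have lef := F_leq_inj injf fk; have leg := F_leq_inj injg gk.
(* Both outer counts are at least [F x y k], which is positive, while their product is at most its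
   square. *)
have eqf : F x y (k - 1)%R = F x y k by nia.
have eqg : F x y (k + 1)%R = F x y k by nia.
split; first by rewrite eqf eqg.
case: wfg => H; [left|right]; split.
- by apply: (Fq_inj_succ injf fk); [rewrite eqf | move=> L /H[]].
- by apply: (Fq_inj_pred injg gk); [rewrite eqg | move=> L /H[]].
- by apply: (Fq_inj_pred injf fk); [rewrite eqf | move=> L /H[]].
- by apply: (Fq_inj_succ injg gk); [rewrite eqg | move=> L /H[]].
Qed.

(** Moving [x] up or [y] down lowers the gap. The weight follows [z] if [z] lies in the first chain;
    otherwise it changes the opposite way, through the neighbour exchanged with [z]. *)
Lemma neighbours_conclusion z : z = x \/ z = y -> neighbours_at z -> gap_conclusion.
Proof.
move=> zxy Hz; pose dn := swap_pos (@ord_pred _) z; pose up := swap_pos (@ordS _) z.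
have injdn : injective dn by apply: swap_pos_inj; exact: bij_inj (ord_pred_bij _).
have injup : injective up by apply: swap_pos_inj; exact: bij_inj (ordS_bij _).
have Hdn L : L \in linexts_gap x y k ->
    [/\ is_linext (dn L), (label (dn L) z).+1 = label L z,
      forall w, w != z -> (w >=< z)%O -> label (dn L) w = label L w,
      z \in codom alpha -> (wgt alpha (dn L)).+1 = wgt alpha L
    & z \notin codom alpha -> wgt alpha (dn L) = (wgt alpha L).+1].
  move=> Lk; have [u [_ [uz _ e _]]] := Hz L Lk.
  by move: Lk; rewrite inE => /andP[linL _]; exact: swap_down linL uz e.
have Hup L : L \in linexts_gap x y k ->
    [/\ is_linext (up L), label (up L) z = (label L z).+1,
      forall w, w != z -> (w >=< z)%O -> label (up L) w = label L w,
      z \in codom alpha -> wgt alpha (up L) = (wgt alpha L).+1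
    & z \notin codom alpha -> (wgt alpha (up L)).+1 = wgt alpha L].
  move=> Lk; have [_ [v [_ vz _ e]]] := Hz L Lk.
  by move: Lk; rewrite inE => /andP[linL _]; exact: swap_up linL vz e.
have gapL L : L \in linexts_gap x y k -> ((label L y)%:Z - (label L x)%:Z = k)%R.
  by rewrite inE => /andP[_ /eqP].
case: zxy => zE; rewrite {}zE in Hdn Hup.
- have yx : y != x by rewrite gt_eqF.
  have cyx : (y >=< x)%O by rewrite comparable_sym lt_comparable.
  apply: (@gap_conclusionP up dn) => // [L Lk|L Lk|].
  + have [lin e ew _ _] := Hup L Lk; rewrite inE lin /= e (ew y) // -(gapL L Lk).
    by apply/eqP; lia.
  + have [lin e ew _ _] := Hdn L Lk; rewrite inE lin /= (ew y) // -(gapL L Lk) -e.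
    by apply/eqP; lia.
  + case: (boolP (x \in codom alpha)) => xa; [left|right] => L Lk;
      by have [_ _ _ h1 h2] := Hup L Lk; have [_ _ _ h3 h4] := Hdn L Lk; split; auto.
- have xNy : x != y by rewrite lt_eqF.
  have cxy : (x >=< y)%O by rewrite lt_comparable.
  apply: (@gap_conclusionP dn up) => // [L Lk|L Lk|].
  + have [lin e ew _ _] := Hdn L Lk; rewrite inE lin /= (ew x) // -(gapL L Lk) -e.
    by apply/eqP; lia.
  + have [lin e ew _ _] := Hup L Lk; rewrite inE lin /= e (ew x) // -(gapL L Lk).
    by apply/eqP; lia.
  + case: (boolP (y \in codom alpha)) => ya; [right|left] => L Lk;
      by have [_ _ _ h1 h2] := Hup L Lk; have [_ _ _ h3 h4] := Hdn L Lk; split; auto.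
Qed.

End Neighbours.

(** * Assembling the equivalences *)

Lemma chain_partition_sym (d : Order.disp_t) (X : finPOrderType d) (a b : nat)
    (alpha : 'I_a -> X) (beta : 'I_b -> X) :
  chain_partition alpha beta -> chain_partition beta alpha.
Proof.
by case=> ha hb cov dis; split=> // [u|u [? ?]]; [case: (cov u); auto | apply: (dis u)].
Qed.

Lemma F_same_chain (d : Order.disp_t) (X : finPOrderType d) (a b : nat)
    (alpha : 'I_a -> X) (beta : 'I_b -> X) (hch : chain_partition alpha beta)
    (x y : X) (k : int) : x <> y -> x \in codom alpha -> y \in codom alpha ->
    (0 < k)%R -> 0 < F x y k ->
  [/\ (x < y)%O, F x y (k - 1)%R * F x y (k + 1)%R <= F x y k ^ 2
    & F x y k ^ 2 = F x y (k - 1)%R * F x y (k + 1)%R ->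
      exists z, (z = x \/ z = y) /\ neighbours_at x y k z].
Proof.
move=> xNy /codomP[r xr] /codomP[s ys] k0 Fk; rewrite {}xr {}ys in xNy Fk *.
(* A positive gap forces [x] to precede [y] in their chain. *)
have rs : r < s.
  move: Fk; rewrite card_gt0 => /set0Pn[L]; rewrite inE => /andP[linL /eqP gapL].
  case: (ltngtP r s) => // [sr|/val_inj rs]; last by rewrite rs in xNy.
  by have := linext_alpha_lt hch linL s r; rewrite sr; move: gapL k0; rewrite /label; lia.
split; first by rewrite (alpha_lt hch).
  exact: (F_alpha_logconcave hch rs Fk).
exact: (F_alpha_eq hch rs Fk).
Qed.

Lemma horner1_Fq (d : Order.disp_t) (X : finPOrderType d) (a : nat)
    (alpha : 'I_a -> X) (x y : X) (j : int) :
  ((Fq alpha x y j).[1] = (F x y j)%:R)%R.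
Proof.
rewrite /Fq horner_sum (eq_bigr (fun=> 1%R)) ?sumr_const // => L _.
by rewrite hornerXn expr1n.
Qed.

Local Open Scope ring_scope.

Theorem theorem1p7 (d : Order.disp_t) (X : finPOrderType d)
    (hwidth : width X = 2%N)
    (a b : nat) (alpha : 'I_a -> X) (beta : 'I_b -> X)
    (hchains : chain_partition alpha beta)
    (x y : X) (hxy : x <> y)
    (hsame : (x \in codom alpha /\ y \in codom alpha) \/
             (x \in codom beta /\ y \in codom beta))
    (k : int) (hk2 : 2 <= k) (hkn : k <= #|X|%:Z - 2)
    (hFk : (0 < F x y k)%N) :
  [<-> (F x y k ^ 2 = F x y (k - 1) * F x y (k + 1))%N ;
       F x y k = F x y (k + 1) /\ F x y (k + 1) = F x y (k - 1) ;
       Fq alpha x y k ^+ 2 = Fq alpha x y (k - 1) * Fq alpha x y (k + 1) ;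
       exists eps : int, (eps = 1 \/ eps = -1) /\
         (to_fracq (Fq alpha x y k)
            = to_fracq 'X ^ eps * to_fracq (Fq alpha x y (k - 1)) /\
          to_fracq 'X ^ eps * to_fracq (Fq alpha x y (k - 1))
            = to_fracq 'X ^ (- eps) * to_fracq (Fq alpha x y (k + 1))) ;
       exists z : X, (z = x \/ z = y) /\
         forall L : {ffun X -> 'I_#|X|}, is_linext L ->
           (label L y)%:Z - (label L x)%:Z = k ->
           exists u v : X, [/\ (u >< z)%O, (v >< z)%O,
             (label L u)%:Z + 1 = (label L z)%:Z
             & (label L z)%:Z = (label L v)%:Z - 1] ].
Proof.
have k0 : 0 < k by lia.
have [xy lc eqF] : [/\ (x < y)%O, (F x y (k - 1) * F x y (k + 1) <= F x y k ^ 2)%N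
    & (F x y k ^ 2 = F x y (k - 1) * F x y (k + 1))%N ->
      exists z, (z = x \/ z = y) /\ neighbours_at x y k z].
  case: hsame => -[xin yin]; first exact: (F_same_chain hchains hxy xin yin k0 hFk).
  (* These conclusions do not involve the weight, so the two chains may be interchanged. *)
  exact: (F_same_chain (chain_partition_sym hchains) hxy xin yin k0 hFk).
have X0 : to_fracq 'X != 0 by rewrite tofrac_eq0 polyX_eq0.
have fM p q : to_fracq (p * q) = to_fracq p * to_fracq q by rewrite /to_fracq rmorphM.
set A := (F x y k ^ 2 = _)%N; set B := _ /\ _; set C := Fq alpha x y k ^+ 2 = _.
set D := (exists eps : int, _); set E := (exists z : X, _).
(* The implications form two cycles through [A] and [E]: [A -> E -> B -> A] and
   [A -> E -> D -> C -> A]. *)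
have AE : A -> E.
  move=> /eqF[z [zxy Hz]]; exists z; split=> // L linL gapL.
  have [|u [v [uz vz eu ev]]] := Hz L; first by rewrite inE linL; apply/eqP.
  by exists u, v; split=> //; [move: eu | move: ev]; clear; lia.
have EX : E -> gap_conclusion alpha x y k.
  move=> [z [zxy Hz]]; apply: (neighbours_conclusion hchains xy hFk lc zxy) => L.
  rewrite inE => /andP[linL /eqP gapL]; have [u [v [uz vz eu ev]]] := Hz L linL gapL.
  by exists u, v; split=> //; [move: eu | move: ev]; clear; lia.
have EB : E -> B by move=> /EX[].
have ED : E -> D.
  move=> /EX[_ [[e1 e2]|[e1 e2]]].
    exists (-1); split; first by right.
    rewrite opprK expr1z exprN1.
    have -> : (to_fracq 'X)^-1 * to_fracq (Fq alpha x y (k - 1)) = to_fracq (Fq alpha x y k).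
      by rewrite e1 fM mulKf.
    by split=> //; rewrite -fM -e2.
  exists 1; split; first by left.
  by rewrite expr1z exprN1 -fM -e1 e2 fM mulKf.
have DC : D -> C.
  move=> [eps [eps1 [e1 e2]]]; apply/eqP; rewrite -tofrac_eq; apply/eqP.
  rewrite -![FracField.tofrac _]/(to_fracq _) expr2 !fM.
  (* One factor of the square is replaced by each expression in (d), and the powers of [q]
     cancel. *)
  by rewrite {1}e1 (etrans e1 e2) mulrACA -expfzDr // subrr expr0z mul1r.
have CA : C -> A.
  (* Evaluation at [q = 1] forgets the weights. *)
  rewrite /C expr2 => /(congr1 (horner^~ 1)); rewrite !hornerM !horner1_Fq.
  by rewrite -!natrM => /eqP; rewrite eqr_nat mulnn => /eqP.
have BA : B -> A by rewrite /A => -[-> ->]; rewrite mulnn.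
tfae; auto.
Qed.
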